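(* Let $(a,b)=(0,\infty)$, let $\lambda\in\mathbb{R}$, and let $\tau=\frac1r\left(-\frac{d}{dx}p\frac{d}{dx}+q\right)$ with $p,q,r$ real-valued, $p,r>0$, $p^{-1},q,r\in L^1_{loc}(0,\infty)$, with $0$ regular and $\infty$ limit point. For $x>1$ put $$P(x)=\int_{x-1/2}^{x+1/2}\frac{dy}{p(y)},\quad r_-(x)=\inf_{y\in[x-1,x+1]}r(y),\quad r_+(x)=\sup_{y\in[x-1,x+1]}r(y),\quad \gamma(x)=\frac{r_+(x)}{r_-(x)},$$ where it is assumed that $0<r_-(x)\le r_+(x)<\infty$ for every such $x$. If the functions $$\gamma(x),\qquad \frac{1}{P(x)^2}\int_{x-1}^{x+1}\frac{1}{r(y)^2}\,dy,\qquad \int_{x-1}^{x+1}\left|\frac{q(y)}{r(y)}-\lambda\right|^2dy$$ are all bounded for $x>1$, then for any solution $u$ of $\tau u=\lambda u$ there exists a constant $C=C(u)$ such that $$\limsup_{x\to\infty}\frac1x\int_0^x\frac{|pu'(y)|^2}{r(y)}\,dy\le C\,\limsup_{x\to\infty}\frac1x\int_0^x|u(y)|^2r(y)\,dy .$$ In this case, if all solutions $u$ of $\tau u=\lambda u$ are bounded in the sense that $\sqrt r\,u$ is a bounded function, then $\lambda\in N(\tau)$.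
   Context: Solutions of $\tau u=\lambda u$ are functions $u$ with $u,pu'$ locally absolutely continuous and $-(pu')'+qu=\lambda r u$ a.e. The endpoint $0$ is regular if $p^{-1},q,r$ are integrable near $0$; $\infty$ is limit point if for some (equivalently every) $z\in\mathbb{C}$ not all solutions of $\tau u=zu$ are in $L^2(r\,dx)$ near $\infty$. With $\|f\|_{(0,x)}=\left(\int_0^x|f(y)|^2r(y)\,dy\right)^{1/2}$, a nonzero solution $u$ of $\tau u=\lambda u$ is called subordinate at $\infty$ with respect to another solution $v$ if $\lim_{x\to\infty}\|u\|_{(0,x)}/\|v\|_{(0,x)}=0$; it is called subordinate at $\infty$ if this holds with respect to some (equivalently, any) linearly independent solution $v$. $N(\tau)=\{\lambda\in\mathbb{R}\mid \text{no solution of }\tau u=\lambda u\text{ is subordinate at }\infty\}$. *)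

(* Defs.v *)
From HB Require Import structures.
From mathcomp Require Import all_boot all_order all_algebra.
From mathcomp Require Import complex.
From mathcomp Require Import all_classical all_reals all_analysis.

Set Implicit Arguments.
Unset Strict Implicit.
Unset Printing Implicit Defensive.

Import Order.TTheory GRing.Theory Num.Theory.
Import numFieldNormedType.Exports.
Import ComplexField.

Local Open Scope classical_set_scope.
Local Open Scope ring_scope.

Section SturmLiouville.
Context {R : realType}.
Implicit Types (p q r f : R -> R) (u v w : R -> R[i]) (z : R[i]) (l x : R).

Local Notation mu := (@lebesgue_measure R).

Definition abs_cont f (a b : R) : Prop :=
  forall e : R, 0 < e -> exists2 d : R, 0 < d &
    forall (n : nat) (B : 'I_n -> R * R),
      (forall i, [/\ a <= (B i).1, (B i).1 <= (B i).2 & (B i).2 <= b]) ->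
      trivIset [set: 'I_n] (fun i => `](B i).1, (B i).2[%classic) ->
      \sum_(i < n) ((B i).2 - (B i).1) < d ->
      \sum_(i < n) `|f (B i).2 - f (B i).1| < e.

Definition loc_abs_cont f : Prop :=
  forall a b : R, 0 < a -> a <= b -> abs_cont f a b.

Definition loc_abs_contC u : Prop :=
  loc_abs_cont (fun x => complex.Re (u x)) /\
  loc_abs_cont (fun x => complex.Im (u x)).

Definition is_deriveC u x (d : R[i]) : Prop :=
  is_derive x 1 (fun y => complex.Re (u y)) (complex.Re d) /\
  is_derive x 1 (fun y => complex.Im (u y)) (complex.Im d).

(* [p u'] is only determined almost everywhere; [w] is its locally absolutely
   continuous (hence unique on (0, +oo)) representative. *)
Definition quasi_derivative p u w : Prop :=
  loc_abs_contC w /\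
  {ae mu, forall x, 0 < x ->
    exists2 d : R[i], is_deriveC u x d & w x = (p x)%:C%C * d}.

Definition is_solution p q r z u : Prop :=
  loc_abs_contC u /\
  exists2 w, quasi_derivative p u w &
    {ae mu, forall x, 0 < x ->
      exists2 d : R[i], is_deriveC w x d &
        - d + (q x)%:C%C * u x = z * (r x)%:C%C * u x}.

Definition sl_coefficients p q r : Prop :=
  [/\ forall x, 0 < x -> 0 < p x,
      forall x, 0 < x -> 0 < r x,
      locally_integrable `]0, +oo[%classic (fun x => (p x)^-1),
      locally_integrable `]0, +oo[%classic q &
      locally_integrable `]0, +oo[%classic r].

Definition regular_at0 p q r : Prop :=
  exists2 c : R, 0 < c &
    [/\ mu.-integrable `]0, c[ (fun x => ((p x)^-1)%:E),
        mu.-integrable `]0, c[ (fun x => (q x)%:E) &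
        mu.-integrable `]0, c[ (fun x => (r x)%:E)].

Definition sq_integrable_near_oo r u : Prop :=
  exists2 c : R, 0 < c &
    (\int[mu]_(x in `]c, +oo[) (Normc.normc (u x) ^+ 2 * r x)%:E < +oo)%E.

Definition limit_point_at_oo p q r : Prop :=
  exists z, ~ (forall u, is_solution p q r z u -> sq_integrable_near_oo r u).

(* Under [regular_at0] the integral is finite for every solution, so that the
   real-valued integral below is not truncated. *)
Definition wnorm r u x : R :=
  Num.sqrt (\int[mu]_(y in `]0, x[) (Normc.normc (u y) ^+ 2 * r y)).

Definition subordinate_wrt r u v : Prop :=
  (wnorm r u x / wnorm r v x) @[x --> +oo] --> (0 : R).

Definition lin_indep u v : Prop :=
  forall a b : R[i], (forall x, 0 < x -> a * u x + b * v x = 0) ->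
    a = 0 /\ b = 0.

Definition subordinate_at_oo p q r z u : Prop :=
  [/\ is_solution p q r z u,
      exists2 x, 0 < x & u x <> 0 &
      exists v, [/\ is_solution p q r z v, lin_indep u v &
                    subordinate_wrt r u v]].

Definition Nset p q r : set R :=
  [set l | ~ exists u, subordinate_at_oo p q r l%:C%C u].

Definition Pint p x : R :=
  \int[mu]_(y in `[x - 1 / 2, x + 1 / 2]) (p y)^-1.

Definition rminus r x : \bar R :=
  ereal_inf [set (r y)%:E | y in `[x - 1, x + 1]].

Definition rplus r x : \bar R :=
  ereal_sup [set (r y)%:E | y in `[x - 1, x + 1]].

Definition gamma r x : R := fine (rplus r x) / fine (rminus r x).

Definition bounded_gt1 (F : R -> \bar R) : Prop :=
  exists M : R, forall x, 1 < x -> (`|F x| <= M%:E)%E.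

Definition limsup_oo (F : R -> \bar R) : \bar R :=
  limf_esup F (pinfty_nbhs R).

End SturmLiouville.

(* Main.v *)
Require Import Defs.
From HB Require Import structures.
From mathcomp Require Import all_boot all_order all_algebra.
From mathcomp Require Import complex.
From mathcomp Require Import all_classical all_reals all_analysis.
From mathcomp Require Import measurable_realfun ring lra.

Import Order.TTheory GRing.Theory Num.Theory.
Import numFieldNormedType.Exports.
Import ComplexField.

Local Open Scope classical_set_scope.
Local Open Scope ring_scope.

(** On a window [x-1, x+1] the equation (pu')' = (q - lambda r) u and Cauchy-Schwarz
    bound the oscillation of pu' by (sup r)^(1/2) times the weighted L^2 norm of u.
    Hence either pu' itself is of that size, or it keeps its sign with |pu'| >= c on the
    window; then u is monotone, increases by at least c P(x) across the middle half, and is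
    therefore of size c P(x)/2 on an outer quarter.  Either way
    |pu'(y)|^2 / r(y) <= K * int_(x-1)^(x+1) |u|^2 r on the window, and summing over windows
    gives the inequality between the averages.  Since x runs down to 1, the windows reach
    the endpoint 0.

    If u is subordinate with respect to v, write the constant Wronskian as u pv' - pu' v,
    integrate over (0, x) and apply Cauchy-Schwarz: |W| x is at most a constant times
    |u|_(0,x+4) |v|_(0,x+4) = o(|v|^2_(0,x+4)) = o(x), so W = 0 and u, v are dependent. *)

(** * Monotonicity of absolutely continuous functions *)

(** Derivatives exist only almost everywhere, so all increments are controlled through one fact: an
    absolutely continuous function with a.e. nonnegative derivative does not decrease. Applied to
    the difference with a primitive, it bounds increments by integrals. Cauchy-Schwarz is used in
    the form: D <= s A + B / s for every s > 0 forces D^2 <= 4 A B; the premise follows by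
    integrating a pointwise inequality. Since [p], [q], [r] and the spectral parameter are real, the
    real and imaginary parts of a solution are themselves solutions, and the complex Wronskian is
    assembled from four real ones. That a vanishing Wronskian forces dependence rests on uniqueness
    for the initial value problem with merely integrable coefficients, obtained on short intervals
    where the integral of the coefficients is at most 1/2. *)

Lemma real_induction (R : realType) (a b : R) (P : R -> Prop) :
  a <= b -> P a ->
  (forall t, a <= t <= b -> exists2 d, 0 < d &
     forall s y, a <= s -> s <= t -> t <= y -> y <= b -> t - d < s -> y < t + d ->
     P s -> P y) ->
  P b.
Proof.
move=> ab Pa step.
pose S := [set t | a <= t <= b /\ P t].
have Sa : S a by split=> //; rewrite lexx.
have hS : has_sup S by split; [exists a|exists b => t [/andP[]]].
have supa : a <= sup S by apply: sup_upper_bound.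
have supb : sup S <= b by apply: ge_sup => [|t [/andP[]]//]; exists a.
have [d d0 hd] := step _ (introT andP (conj supa supb)).
have [t [/andP[at_ tb] Pt] tS] := sup_adherent d0 hS.
have tle : t <= sup S by apply: sup_upper_bound => //; split=> //; apply/andP.
(* Unless the supremum is already [b], this [y] lies beyond it, yet [hd] puts it in [S]. *)
pose y := Num.min b (sup S + d / 2).
have yS : sup S <= y by rewrite /y le_min supb/=; lra.
have yb : y <= b by rewrite /y ge_min lexx.
have yd : y < sup S + d by rewrite /y gt_min; apply/orP; right; lra.
have Py := hd t y at_ tle yS yb tS yd Pt.
have : y <= sup S.
  by apply: sup_upper_bound => //; split=> //; apply/andP; split=> //; lra.
rewrite /y ge_min => /orP[bS|]; last by lra.
suff <- : y = b by [].
by apply/eqP; rewrite eq_le yb /=; lra.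
Qed.

Section abs_cont_monotone.
Context {R : realType}.
Local Notation mu := (@lebesgue_measure R).
Implicit Types (f g h : R -> R) (a b t : R) (O : set R) (l : seq (R * R)).

(* The most recent (rightmost) interval comes first. *)
Fixpoint chain a O l t : Prop :=
  if l is z :: l' then
    [/\ a <= z.1, z.1 <= z.2, z.2 <= t, `]z.1, z.2[ `<=` O & chain a O l' z.1]
  else True.

Lemma chain_nth a O l t i : chain a O l t -> (i < size l)%N ->
  [/\ a <= (nth (0, 0) l i).1, (nth (0, 0) l i).1 <= (nth (0, 0) l i).2,
      (nth (0, 0) l i).2 <= t &
      `](nth (0, 0) l i).1, (nth (0, 0) l i).2[ `<=` O].
Proof.
elim: l t i => //= z l IH t [|i] [az zz zt zO ch] //= il.
have [? ? ? ?] := IH _ _ ch il; split=> //; lra.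
Qed.

Lemma chain_nth_lt a O l t i j : chain a O l t -> (i < j < size l)%N ->
  (nth (0, 0) l j).2 <= (nth (0, 0) l i).1.
Proof.
elim: l t i j => [|z l IH] t i [|j] //=; rewrite ?andbF// ltnS.
move=> [az zz zt zO ch]; case: i => [|i] /= ijl.
  by have [_ _ + _] := chain_nth _ _ _ _ _ ch ijl.
by apply: IH ch _.
Qed.

Lemma sum_length_mu n (B : 'I_n -> R * R) :
  (forall i, (B i).1 <= (B i).2) ->
  trivIset [set: 'I_n] (fun i => `](B i).1, (B i).2[%classic) ->
  (\sum_(i < n) ((B i).2 - (B i).1))%:E =
  mu (\big[setU/set0]_(i < n) `](B i).1, (B i).2[%classic).
Proof.
move=> le12 tr; rewrite measure_bigsetU_ord// -sumEFin.
apply: eq_bigr => i _; rewrite /= lebesgue_measure_itv/= lte_fin.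
have := le12 i; rewrite le_eqVlt => /orP[/eqP ->|->]; last by rewrite EFinB.
by rewrite ltxx subrr.
Qed.

(** Disjoint intervals inside [O] have total length at most [mu O]; the conclusion has the form that
    [abs_cont] asks for. *)
Lemma chain_length a O l t (d : R) : open O -> (mu O < d%:E)%E ->
  chain a O l t -> \sum_(i < size l) ((nth (0, 0) l i).2 - (nth (0, 0) l i).1) < d
  /\ trivIset [set: 'I_(size l)]
      (fun i => `](nth (0, 0) l i).1, (nth (0, 0) l i).2[%classic).
Proof.
move=> oO mO ch.
have tr : trivIset [set: 'I_(size l)]
    (fun i => `](nth (0, 0) l i).1, (nth (0, 0) l i).2[%classic).
  move=> i j _ _ [x []] /=; rewrite !in_itv /= => /andP[x1 x2] /andP[x3 x4].
  apply/val_inj/eqP; rewrite eqn_leq; apply/andP; split; rewrite leqNgt; apply/negP => ij.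
  - have /= := @chain_nth_lt _ _ _ _ j i ch; rewrite ij ltn_ord => /(_ isT); lra.
  - have /= := @chain_nth_lt _ _ _ _ i j ch; rewrite ij ltn_ord => /(_ isT); lra.
split=> //; rewrite -lte_fin; apply: le_lt_trans mO.
rewrite (sum_length_mu _ (fun i => nth (0, 0) l (nat_of_ord i)))//; last first.
  by move=> i; have [] := chain_nth _ _ _ _ _ ch (ltn_ord i).
apply: le_measure; rewrite ?inE; [exact: bigsetU_measurable|exact: open_measurable|].
move=> x; rewrite -bigcup_seq => -[i _ /=].
by have [_ _ _] := chain_nth _ _ _ _ _ ch (ltn_ord i); exact.
Qed.

Lemma is_derive_ge f t (d e : R) : 0 < e -> is_derive t 1 f d ->
  exists2 k, 0 < k & forall y, `|y - t| < k ->
    `|f y - f t - (y - t) * d| <= e * `|y - t|.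
Proof.
move=> e0 [df dE].
have : (h^-1 *: ((f \o shift t) (h *: (1 : R)) - f t)) @[h --> 0^'] --> d.
  by rewrite -dE; exact: df.
move=> /cvgrPdist_le /(_ e e0) [k /= k0 hk]; exists k => // y yt.
have [->|yt0] := eqVneq y t; first by rewrite !subrr mul0r subr0 !normr0 mulr0.
have := hk (y - t); rewrite /= sub0r normrN subr_eq0 => /(_ yt yt0).
rewrite [_%:A]mulr1 subrK => H.
have -> : f y - f t - (y - t) * d = - (y - t) * (d - (y - t)^-1 * (f y - f t)).
  by field; rewrite subr_eq0.
by rewrite normrM normrN mulrC ler_wpM2r.
Qed.

(* Real induction along [a, b], leaving out intervals around the bad null set:
   they sit in an open set of small measure, so that the total variation of [f]
   on them is small by absolute continuity. *)
Lemma abs_cont_ge0_le f a b : a <= b -> abs_cont f a b ->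
  {ae mu, forall x, a < x < b -> exists2 d, is_derive x 1 f d & 0 <= d} ->
  f a <= f b.
Proof.
move=> ab acf [N0 [mN0 N00 sub0]].
(* The endpoints join the exceptional set because the hypothesis speaks of the open interval
   only. *)
pose N := N0 `|` [set a] `|` [set b].
have mN : measurable N by do 2 (apply: measurableU => //).
have N_0 : mu N = 0%E.
  rewrite !measureU0//; try exact: lebesgue_measure_set1.
  exact: measurableU.
suff key (e : R) : 0 < e -> f a - f b <= e * (b - a) + e.
  apply/ler_addgt0Pr => e e0.
  have k0 : 0 < b - a + 1 by lra.
  have := key (e / (b - a + 1)) (divr_gt0 e0 k0).
  rewrite -[in X in _ <= _ + X](mulr1 (e / _)) -mulrDr divfK ?gt_eqF//; lra.
move=> e0; have [d d0 hd] := acf e e0.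
have mNoo : (mu N < +oo)%E by rewrite N_0 ltry.
have [V [oV NV mV]] := lebesgue_regularity_outer mN mNoo d0.
have {}mV : (mu V < d%:E)%E.
  have -> : V = (V `\` N) `|` N by rewrite setUC setDUK.
  rewrite measureU0//; apply: measurableD => //; exact: open_measurable.
(* The loss of [f] up to [t] has two sources: slope at least -e at good points, and the variation
   over the chain intervals, which absolute continuity keeps below e. *)
pose P t := exists2 l, chain a V l t &
  f a - f t <= e * (t - a) + \sum_(z <- l) `|f z.2 - f z.1|.
have [l ch] : P b.
  apply: (@real_induction R a b P ab).
    by exists [::] => //; rewrite big_nil !subrr mulr0 addr0.
  move=> t /andP[at_ tb].
  (* Near a point of [N] the whole passage from [s] to [y] is charged to a new chain interval inside
     [V]; near any other point the derivative controls it and the chain is kept. *)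
  have [tN|tN] := pselect (N t).
    have := NV t tN; move: (oV); rewrite openE => /[apply] -[k /= k0 hk].
    exists k => // s y as_ st ty yb ks ky [l ch hl].
    exists ((s, y) :: l) => /=.
      split=> //; first exact: le_trans st ty.
      move=> x; rewrite /= in_itv /= => /andP[sx xy]; apply: hk => /=.
      by rewrite ltr_norml; apply/andP; split; lra.
    rewrite big_cons /=.
    have : f s - f y <= `|f y - f s| by rewrite distrC ler_norm.
    have : 0 <= e * (y - s) by rewrite mulr_ge0 ?(ltW e0)//; lra.
    lra.
  have tab : a < t < b.
    rewrite !lt_neqAle at_ tb !andbT; apply/andP; split; apply/eqP => E; apply: tN.
      by left; right.
    by right.
  have [D hD D0] : exists2 d, is_derive t 1 f d & 0 <= d.
    by apply: contrapT => H; apply: tN; left; left; apply: sub0 => /(_ tab).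
  have [k k0 hk] := is_derive_ge _ _ _ e e0 hD.
  exists k => // s y as_ st ty yb ks ky [l ch hl].
  exists l.
    case: l ch {hl} => //= z l [? ? ? ? ?]; split=> //; lra.
  have hs : `|s - t| = t - s by rewrite distrC ger0_norm; lra.
  have hy : `|y - t| = y - t by rewrite ger0_norm; lra.
  have := hk s; rewrite hs ler_norml => /(_ ltac:(lra)) /andP[h1 h2].
  have := hk y; rewrite hy ler_norml => /(_ ltac:(lra)) /andP[h3 h4].
  have : 0 <= (y - t) * D by apply: mulr_ge0 => //; lra.
  have : 0 <= (t - s) * D by apply: mulr_ge0 => //; lra.
  nra.
have [lenl trl] := chain_length _ _ _ _ _ oV mV ch.
have := hd (size l) (fun i => nth (0, 0) l i).
move=> /(_ (fun i => let: And4 h1 h2 h3 _ := chain_nth _ _ _ _ _ ch (ltn_ord i) in And3 h1 h2 h3)).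
move=> /(_ trl lenl); rewrite (big_nth (0, 0)) big_mkord; lra.
Qed.

End abs_cont_monotone.

(** * Calculus of absolutely continuous functions *)

Section abs_cont_theory.
Context {R : realType}.
Local Notation mu := (@lebesgue_measure R).
Implicit Types (f g h : R -> R) (a b t : R).

Lemma ae_impl (P Q : R -> Prop) : (forall x, P x -> Q x) ->
  {ae mu, forall x, P x} -> {ae mu, forall x, Q x}.
Proof. by move=> PQ; apply: filterS; first exact: (ae_filter_ringOfSetsType mu). Qed.

Lemma ae_impl2 (P1 P2 Q : R -> Prop) : (forall x, P1 x -> P2 x -> Q x) ->
  {ae mu, forall x, P1 x} -> {ae mu, forall x, P2 x} -> {ae mu, forall x, Q x}.
Proof. by move=> PQ; apply: filterS2; first exact: (ae_filter_ringOfSetsType mu). Qed.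

(** A single criterion for sums, multiples and bounded products: the variation of [f] and that of
    [g] may each use up e / (2 C). *)
Lemma abs_cont_dominated f g h a b (C : R) : 0 < C ->
  abs_cont f a b -> abs_cont g a b ->
  (forall x y, a <= x -> x <= y -> y <= b ->
     `|h y - h x| <= C * (`|f y - f x| + `|g y - g x|)) ->
  abs_cont h a b.
Proof.
move=> C0 acf acg hC e e0.
have e'0 : 0 < e / (2 * C) by rewrite divr_gt0// mulr_gt0.
have [d1 d10 h1] := acf _ e'0; have [d2 d20 h2] := acg _ e'0.
exists (Num.min d1 d2); first by rewrite lt_min d10.
move=> n B hB tr; rewrite lt_min => /andP[l1 l2].
apply: (@le_lt_trans _ _ (\sum_(i < n) C * (`|f (B i).2 - f (B i).1| +
   `|g (B i).2 - g (B i).1|))).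
  by apply: ler_sum => i _; have [? ? ?] := hB i; exact: hC.
rewrite -mulr_sumr big_split/=.
have := h1 n B hB tr l1; have := h2 n B hB tr l2.
set x := \sum_(i < n) _; set y := \sum_(i < n) _ => hx hy.
have -> : e = C * (e / (2 * C) + e / (2 * C)) by field; rewrite gt_eqF.
by rewrite ltr_pM2l// ltrD.
Qed.

Lemma abs_contD f g a b : abs_cont f a b -> abs_cont g a b ->
  abs_cont (fun x => f x + g x) a b.
Proof.
move=> acf acg; apply: (@abs_cont_dominated f g _ a b 1) => // x y _ _ _.
by rewrite mul1r opprD addrACA ler_normD.
Qed.

Lemma abs_contZ (c : R) f a b : abs_cont f a b -> abs_cont (fun x => c * f x) a b.
Proof.
move=> acf; apply: (@abs_cont_dominated f f _ a b (`|c| + 1)) => //.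
move=> x y _ _ _; rewrite -mulrBr normrM.
have := normr_ge0 c; have := normr_ge0 (f y - f x); nra.
Qed.

Lemma abs_contN f a b : abs_cont f a b -> abs_cont (fun x => - f x) a b.
Proof.
move=> acf; apply: (@abs_cont_dominated f f _ a b 1) => //.
by move=> x y _ _ _; rewrite mul1r -opprD normrN lerDl.
Qed.

Lemma abs_contM_bounded f g a b (M : R) : 0 < M ->
  (forall x, a <= x <= b -> `|f x| <= M) -> (forall x, a <= x <= b -> `|g x| <= M) ->
  abs_cont f a b -> abs_cont g a b -> abs_cont (fun x => f x * g x) a b.
Proof.
move=> M0 hf hg acf acg; apply: (@abs_cont_dominated f g _ a b M) => //.
move=> x y ax xy yb.
have -> : f y * g y - f x * g x = (f y - f x) * g y + f x * (g y - g x) by ring.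
rewrite (le_trans (ler_normD _ _))// !normrM mulrDr lerD//.
  by rewrite mulrC ler_wpM2r// hg// yb (le_trans ax).
by rewrite ler_wpM2r// hf// ax (le_trans xy).
Qed.

Lemma loc_abs_cont_continuous f (x : R) : loc_abs_cont f -> 0 < x -> {for x, continuous f}.
Proof.
move=> acf x0; apply/cvgrPdist_lt => e e0.
have [d d0 hd] := acf (x / 2) (x + 1) ltac:(lra) ltac:(lra) e e0.
have key s t : x / 2 <= s -> s <= t -> t <= x + 1 -> t - s < d -> `|f t - f s| < e.
  move=> xs st tx ts; have := hd 1%N (fun=> (s, t)).
  rewrite !big_ord1/=; apply => //.
  by move=> i j _ _ _; rewrite !ord1.
apply/nbhs_ballP; exists (Num.min d (Num.min (x / 2) 1)) => /=.
  by rewrite !lt_min d0/=; lra.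
move=> y; rewrite /ball/=.
rewrite !lt_min !ltr_norml => /and3P[/andP[? ?] /andP[? ?] /andP[? ?]].
have [xy|/ltW yx] := leP x y.
  by rewrite -ltr_norml distrC; apply: key; lra.
by rewrite -ltr_norml; apply: key; lra.
Qed.

Lemma loc_abs_cont_norm_max f a b : loc_abs_cont f -> 0 < a -> a <= b ->
  exists2 c, a <= c <= b & forall x, a <= x <= b -> `|f x| <= `|f c|.
Proof.
move=> acf a0 ab.
have [|c] := @EVT_max R (fun x => `|f x|) a b ab.
  apply: continuous_in_subspaceT => x.
  rewrite inE/= in_itv/= => /andP[ax _].
  apply: cvg_norm; exact: (loc_abs_cont_continuous) (lt_le_trans a0 ax).
by rewrite in_itv/= => cab hc; exists c.
Qed.

Lemma loc_abs_cont_bounded f a b : loc_abs_cont f -> 0 < a ->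
  exists2 M, 0 < M & forall x, a <= x <= b -> `|f x| <= M.
Proof.
move=> acf a0; have [ab|ba] := leP a b; last first.
  by exists 1 => // x /andP[ax xb]; lra.
have [c cab hc] := loc_abs_cont_norm_max _ _ _ acf a0 ab.
exists (`|f c| + 1); first by rewrite ltr_pwDr.
by move=> x /hc; lra.
Qed.

Lemma loc_abs_cont_measurable f : loc_abs_cont f -> measurable_fun (`]0, +oo[%classic : set R) f.
Proof.
move=> acf; apply: open_continuous_measurable_fun; first exact: interval_open.
move=> x; rewrite inE/= in_itv/= andbT; exact: (loc_abs_cont_continuous).
Qed.

Lemma loc_abs_contD f g : loc_abs_cont f -> loc_abs_cont g ->
  loc_abs_cont (fun x => f x + g x).
Proof. by move=> hf hg a b a0 ab; apply: abs_contD; [exact: hf|exact: hg]. Qed.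

Lemma loc_abs_contZ (c : R) f : loc_abs_cont f -> loc_abs_cont (fun x => c * f x).
Proof. by move=> hf a b a0 ab; apply: abs_contZ; exact: hf. Qed.

Lemma loc_abs_contM f g : loc_abs_cont f -> loc_abs_cont g ->
  loc_abs_cont (fun x => f x * g x).
Proof.
move=> hf hg a b a0 ab.
have [M M0 hM] := loc_abs_cont_bounded f a b hf a0.
have [N N0 hN] := loc_abs_cont_bounded g a b hg a0.
apply: (@abs_contM_bounded _ _ a b (M + N)); first exact: addr_gt0.
- by move=> x /hM; lra.
- by move=> x /hN; lra.
- exact: hf.
- exact: hg.
Qed.

(** Absolute continuity of the Lebesgue integral, applied to the union of the given intervals. *)
Lemma abs_cont_primitive h a b : mu.-integrable setT (EFin \o h) ->
  abs_cont (fun x => \int[mu]_(t in `]-oo, x]) h t) a b.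
Proof.
move=> ih e e0; have [d [d0 hd]] := integral_normr_continuous ih e0.
exists d => // n B hB tr len.
pose I i := `](B i).1, (B i).2[%classic.
have mA : measurable (\big[setU/set0]_(i < n) I i).
  by apply: bigsetU_measurable => i _; exact: measurable_itv.
have mh : measurable_fun setT h by case/integrableP : ih => /measurable_EFinP.
apply: le_lt_trans (hd _ mA _); last first.
  move: len; rewrite -lte_fin sum_length_mu//.
  by move=> i; have [] := hB i.
have inh D : measurable D -> mu.-integrable D (EFin \o (fun x => `|h x|)).
  by move=> mD; apply: integrableS (integrable_norm ih).
rewrite -lee_fin /Rintegral fineK; last first.
  by apply: integrable_fin_num => //; exact: inh.
rewrite (@ge0_integral_bigsetU _ _ _ mu _ I _ (index_enum _))//; last 4 first.
- by move=> i; exact: measurable_itv.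
- exact: index_enum_uniq.
- by move=> i j _ _; exact: tr.
- by apply/measurable_EFinP; apply: measurableT_comp => //; apply: measurable_funTS.
rewrite -sumEFin; apply: lee_sum => i _.
have [_ le12 _] := hB i.
rewrite Rintegral_itvB//; last first.
  by apply: integrableS ih.
rewrite -Rintegral_itv_bndo_bndc; last by apply: integrableS ih.
rewrite EFin_normr_Rintegral//; last by apply: integrableS ih.
apply: le_abse_integral => //.
by apply/measurable_EFinP; apply: measurable_funTS.
Qed.

Lemma ae_is_derive_primitive h : mu.-integrable setT (EFin \o h) ->
  {ae mu, forall x : R, is_derive x 1 (fun x : R => \int[mu]_(t in `]-oo, x]) h t) (h x)}.
Proof.
move=> ih; have locf : locally_integrable setT h.
  by apply: open_integrable_locally => //; exact: openT.
have ihy y : mu.-integrable `]-oo, y] (EFin \o h) by apply: integrableS ih.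
have := FTC1Ny ihy locf; apply: ae_impl => x [dx dE].
by split; [exact: dx|rewrite -derive1E; exact: dE].
Qed.

(** If F is a primitive of [h], then F - f has an a.e. nonnegative derivative, so it does not
    decrease. *)
Lemma abs_cont_le_integral f h a b : a <= b -> abs_cont f a b ->
  mu.-integrable `[a, b] (EFin \o h) ->
  {ae mu, forall x : R, a < x < b -> exists2 d, is_derive x 1 f d & d <= h x} ->
  f b - f a <= \int[mu]_(t in `[a, b]) h t.
Proof.
(* Cutting [h] off outside [a, b] makes it integrable on the whole line, so that the primitive can
   start at -oo. *)
move=> ab acf ih dfh; pose k := h \_ `[a, b].
have ik : mu.-integrable setT (EFin \o k).
  rewrite /k -restrict_EFin; apply/integrable_restrict => //.
  by rewrite setTI.
pose F x := \int[mu]_(t in `]-oo, x]) k t.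
have FE : F b - F a = \int[mu]_(t in `[a, b]) h t.
  rewrite /F Rintegral_itvB//; last by apply: integrableS ik.
  rewrite Rintegral_itv_obnd_cbnd; last by apply: integrableS ik.
  by apply: eq_Rintegral => x xab; rewrite /k patchE xab.
rewrite -FE.
suff : F a - f a <= F b - f b by lra.
apply: (@abs_cont_ge0_le _ (fun x => F x - f x)) => //.
  by apply: abs_contD; [exact: abs_cont_primitive|exact: abs_contN].
have := ae_is_derive_primitive k ik; move: dfh; apply: ae_impl2 => x dfx dFx xab.
have [d hd dh] := dfx xab; exists (k x - d); first exact: is_deriveB.
rewrite subr_ge0 /k patchE mem_set// /= in_itv/=; lra.
Qed.

Lemma abs_cont_ge_integral f h a b : a <= b -> abs_cont f a b ->
  mu.-integrable `[a, b] (EFin \o h) ->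
  {ae mu, forall x : R, a < x < b -> exists2 d, is_derive x 1 f d & h x <= d} ->
  \int[mu]_(t in `[a, b]) h t <= f b - f a.
Proof.
move=> ab acf ih dfh.
have := @abs_cont_le_integral (fun x => - f x) (fun x => (-1) * h x) a b ab.
rewrite RintegralZl//.
suff H : - f b - - f a <= -1 * \int[mu]_(x in `[a, b]) h x ->
   \int[mu]_(t in `[a, b]) h t <= f b - f a.
  move=> K; apply: H; apply: K; first exact: abs_contN.
    exact: (integrableZl _ (-1) ih).
  move: dfh; apply: ae_impl => x dfx xab; have [d hd dh] := dfx xab.
  by exists (- d); [exact: is_deriveN|lra].
lra.
Qed.

Lemma abs_cont_norm_le_integral f h a b : a <= b -> abs_cont f a b ->
  mu.-integrable `[a, b] (EFin \o h) ->
  {ae mu, forall x : R, a < x < b -> exists2 d, is_derive x 1 f d & `|d| <= h x} ->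
  `|f b - f a| <= \int[mu]_(t in `[a, b]) h t.
Proof.
move=> ab acf ih dfh; rewrite ler_norml; apply/andP; split; last first.
  apply: abs_cont_le_integral => //; move: dfh; apply: ae_impl => x dfx xab.
  by have [d hd] := dfx xab; rewrite ler_norml => /andP[_ ?]; exists d.
have : \int[mu]_(t in `[a, b]) ((-1) * h t) <= f b - f a.
  apply: abs_cont_ge_integral => //.
    exact: (integrableZl _ (-1) ih).
  move: dfh; apply: ae_impl => x dfx xab.
  by have [d hd] := dfx xab; rewrite ler_norml => /andP[? _]; exists d => //; lra.
by rewrite RintegralZl// mulN1r.
Qed.

End abs_cont_theory.

(** * Integrals over compact subintervals of the half-line *)

Section integral_tools.
Context {R : realType}.
Local Notation mu := (@lebesgue_measure R).
Implicit Types (f g h : R -> R) (a b : R).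

Lemma ae_dense (P : R -> Prop) x e : {ae mu, forall y, P y} -> 0 < e ->
  exists2 y, x < y < x + e & P y.
Proof.
move=> [N [mN N0 PN]] e0; apply: contrapT => H.
have sub : `]x, x + e[%classic `<=` N.
  move=> y; rewrite /= in_itv/= => xye; apply: PN => /= Py.
  by apply: H; exists y.
have : (mu `]x, (x + e)%R[ <= mu N)%E by apply: le_measure; rewrite ?inE.
rewrite N0 lebesgue_measure_itv/= lte_fin ltrDl e0 -EFinB lee_fin; lra.
Qed.

Lemma loc_abs_cont_ae_eq0 f : loc_abs_cont f ->
  {ae mu, forall x, 0 < x -> f x = 0} -> forall x, 0 < x -> f x = 0.
Proof.
move=> acf f0 x x0; apply/eqP/negP => /negP fx.
have := loc_abs_cont_continuous _ _ acf x0.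
move=> /cvgrPdist_lt /(_ `|f x|); rewrite normr_gt0 => /(_ fx).
move=> /nbhs_ballP[e /= e0 he].
have [y /andP[xy ye] fy] := ae_dense _ x _ f0 e0.
have fy0 : f y = 0 by apply: fy; lra.
suff : `|f x - f y| < `|f x| by rewrite fy0 subr0 ltxx.
by apply: he; rewrite /ball/= distrC ger0_norm; lra.
Qed.

Lemma locally_integrable_itv f a b :
  locally_integrable (`]0, +oo[%classic : set R) f -> 0 < a ->
  mu.-integrable `[a, b] (EFin \o f).
Proof.
move=> [mf _ fK] a0.
have sub : `[a, b]%classic `<=` (`]0, +oo[%classic : set R).
  by move=> x; rewrite /= !in_itv/= andbT => /andP[? _]; lra.
apply/integrableP; split.
  by apply/measurable_EFinP; apply: measurable_funS mf.
by apply: fK => //; exact: segment_compact.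
Qed.

Lemma integrable_square_weight r f a b :
  locally_integrable (`]0, +oo[%classic : set R) r ->
  loc_abs_cont f -> 0 < a ->
  mu.-integrable `[a, b] (EFin \o (fun x => f x ^+ 2 * r x)).
Proof.
move=> lr acf a0.
have [M M0 hM] := loc_abs_cont_bounded f a b acf a0.
have ir := locally_integrable_itv r a b lr a0.
have sub : `[a, b]%classic `<=` (`]0, +oo[%classic : set R).
  by move=> x; rewrite /= !in_itv/= andbT => /andP[? _]; lra.
apply: (@le_integrable _ _ _ mu `[a, b] _ _ (EFin \o (fun x => M ^+ 2 * r x))) => //.
- apply/measurable_EFinP; apply: measurable_funM.
    apply: measurable_funX.
    by apply: measurable_funS (loc_abs_cont_measurable f acf).
  by case: lr => mr _ _; apply: measurable_funS mr.
- move=> x; rewrite /= in_itv/= => xab.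
  rewrite lee_fin !(normrM (_ ^+ 2)) ler_wpM2r// !normrX lerXn2r ?nnegrE//.
  by rewrite (gtr0_norm M0) hM.
- exact: (integrableZl _ (M ^+ 2) ir).
Qed.

Lemma osc_le_integral f h a b : loc_abs_cont f -> 0 < a ->
  mu.-integrable `[a, b] (EFin \o h) -> (forall x, a <= x <= b -> 0 <= h x) ->
  {ae mu, forall x : R, a < x < b -> exists2 d, is_derive x 1 f d & `|d| <= h x} ->
  forall x y, a <= x <= b -> a <= y <= b ->
  `|f y - f x| <= \int[mu]_(t in `[a, b]) h t.
Proof.
move=> acf a0 ih h0 dfh.
suff key x y : a <= x -> x <= y -> y <= b ->
    `|f y - f x| <= \int[mu]_(t in `[a, b]) h t.
  move=> x y /andP[ax xb] /andP[ay yb].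
  by have [xy|/ltW yx] := leP x y; [|rewrite distrC]; exact: key.
move=> ax xy yb.
have sub : `[x, y]%classic `<=` `[a, b]%classic.
  by move=> z; rewrite /= !in_itv/= => /andP[? ?]; apply/andP; split; lra.
have ixy : mu.-integrable `[x, y] (EFin \o h) by apply: integrableS ih.
apply: (@le_trans _ _ (\int[mu]_(t in `[x, y]) h t)).
  apply: abs_cont_norm_le_integral => //; first by apply: acf => //; lra.
  by move: dfh; apply: ae_impl => z dz /andP[xz zy]; apply: dz; lra.
rewrite -lee_fin /Rintegral !fineK; try exact: integrable_fin_num.
by apply: ge0_subset_integral => //; case/integrableP : ih.
Qed.

End integral_tools.

(** The minimum of s A + B / s is 2 sqrt(A B). Inserting s = D / (2 A) instead of the minimiser
    gives the same bound without roots. *)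
Lemma sqr_le_of_weighted (R : realFieldType) (D A B : R) : 0 <= A -> 0 <= B ->
  0 <= D -> (forall s, 0 < s -> D <= s * A + B / s) -> D ^+ 2 <= 4 * A * B.
Proof.
move=> A0 B0; rewrite le_eqVlt => /orP[/eqP <- _|D0 H].
  by rewrite expr0n/= !mulr_ge0.
have [A00|A_neq0] := eqVneq A 0.
  (* If A = 0, this s makes B / s strictly smaller than D, a contradiction. *)
  have s0 : 0 < (B + 1) / D by rewrite divr_gt0//; lra.
  have := H _ s0; rewrite A00 mulr0 add0r invf_div => h.
  have B1 : 0 < B + 1 by lra.
  by move: h; rewrite mulrA ler_pdivlMr//; lra.
have A_gt0 : 0 < A by rewrite lt_neqAle eq_sym A_neq0.
have s0 : 0 < D / (2 * A) by rewrite divr_gt0// mulr_gt0.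
have := H _ s0.
have -> : D / (2 * A) * A = D / 2 by field.
rewrite invf_div => h.
have {}h : D / 2 <= B * (2 * A) / D by rewrite -mulrA; lra.
by move: h; rewrite ler_pdivlMr// => h; rewrite expr2; lra.
Qed.

(** * The equation as a real first-order system, and its Wronskian *)

Section real_solutions.
Context {R : realType} (p q r : R -> R) (l : R).
Local Notation mu := (@lebesgue_measure R).
Implicit Types (U W : R -> R).

(** [W] stands for the quasi-derivative pU'. It is carried along as a function of its own because
    pU' is defined only almost everywhere, while [W] is absolutely continuous. *)
Definition real_solution U W :=
  [/\ loc_abs_cont U, loc_abs_cont W,
      {ae mu, forall x : R, 0 < x -> is_derive x 1 U (W x / p x)} &
      {ae mu, forall x : R, 0 < x -> is_derive x 1 W ((q x - l * r x) * U x)}].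

Lemma real_solutionD U1 W1 U2 W2 : real_solution U1 W1 -> real_solution U2 W2 ->
  real_solution (fun x => U1 x + U2 x) (fun x => W1 x + W2 x).
Proof.
move=> [aU1 aW1 dU1 dW1] [aU2 aW2 dU2 dW2]; split.
- exact: loc_abs_contD.
- exact: loc_abs_contD.
- move: dU1 dU2; apply: ae_impl2 => x h1 h2 x0.
  by rewrite mulrDl; apply: is_deriveD; [exact: h1|exact: h2].
- move: dW1 dW2; apply: ae_impl2 => x h1 h2 x0.
  by rewrite mulrDr; apply: is_deriveD; [exact: h1|exact: h2].
Qed.

Lemma real_solutionZ c U W : real_solution U W ->
  real_solution (fun x => c * U x) (fun x => c * W x).
Proof.
move=> [aU aW dU dW]; split.
- exact: loc_abs_contZ.
- exact: loc_abs_contZ.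
- move: dU; apply: ae_impl => x h x0; rewrite -mulrA.
  by apply: (@is_deriveZ _ _ _ U c x 1); exact: h.
- move: dW; apply: ae_impl => x h x0; rewrite mulrCA.
  by apply: (@is_deriveZ _ _ _ W c x 1); exact: h.
Qed.

(** In the derivative the terms W1 W2 / p and (q - l r) U1 U2 each occur twice with opposite signs.
    Hence both [F] and its negative are nondecreasing. *)
Lemma wronskian_constant U1 W1 U2 W2 : real_solution U1 W1 -> real_solution U2 W2 ->
  exists c, forall x, 0 < x -> U1 x * W2 x - W1 x * U2 x = c.
Proof.
move=> [aU1 aW1 dU1 dW1] [aU2 aW2 dU2 dW2].
pose F x := U1 x * W2 x + (-1) * (W1 x * U2 x).
have aF : loc_abs_cont F.
  by apply: loc_abs_contD; [|apply: loc_abs_contZ]; exact: loc_abs_contM.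
have dF : {ae mu, forall x : R, 0 < x -> is_derive x 1 F 0}.
  have d12 := ae_impl2 _ _ _ (fun x h1 h2 => conj h1 h2) dU1 dW1.
  have d34 := ae_impl2 _ _ _ (fun x h1 h2 => conj h1 h2) dU2 dW2.
  move: d12 d34; apply: ae_impl2 => x [h1 h2] [h3 h4] x0.
  have := is_deriveD (is_deriveM (h1 x0) (h4 x0))
    (is_deriveZ (-1) (is_deriveM (h2 x0) (h3 x0))).
  move=> H; apply: is_derive_eq H _; rewrite /GRing.scale/=; ring.
exists (F 1) => x x0.
have -> : U1 x * W2 x - W1 x * U2 x = F x by rewrite /F mulN1r.
have key a b : 0 < a -> a <= b -> F b = F a.
  move=> a0 ab; apply/eqP; rewrite eq_le; apply/andP; split.
    rewrite -lerN2; apply: (@abs_cont_ge0_le _ (fun x => - F x)) => //.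
      by apply: abs_contN; exact: aF.
    move: dF; apply: ae_impl => y h /andP[ay _]; exists (- 0); last by rewrite oppr0.
    by apply: is_deriveN; apply: h; lra.
  apply: abs_cont_ge0_le => //; first exact: aF.
  by move: dF; apply: ae_impl => y h /andP[ay _]; exists 0 => //; apply: h; lra.
by have [x1|/ltW x1] := leP x 1; [apply/esym|]; exact: key.
Qed.

End real_solutions.

(** * The estimate on a window *)

Section uniqueness.
Context {R : realType} (p q r : R -> R) (l : R).
Hypothesis coef : sl_coefficients p q r.
Local Notation mu := (@lebesgue_measure R).
Implicit Types (U W : R -> R).

(** A common majorant of both coefficients of the system: |U'| <= h |W| and |W'| <= h |U| almost
    everywhere. *)
Let h x : R := (p x)^-1 + (`|q x| + `|l * r x|).

Let h_ge0 x : 0 < x -> 0 <= h x.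
Proof.
by case: coef => p0 _ _ _ _ x0; rewrite /h !addr_ge0// invr_ge0 ltW// p0.
Qed.

Let integrable_h a b : 0 < a -> mu.-integrable `[a, b] (EFin \o h).
Proof.
move=> a0; case: coef => p0 r0 ip iq ir.
have i1 := locally_integrable_itv _ a b ip a0.
have i2 := integrable_norm (locally_integrable_itv _ a b iq a0).
have i3 : mu.-integrable `[a, b] (EFin \o (fun x => `|l * r x|)).
  have irl := locally_integrable_itv _ a b ir a0.
  by apply: integrable_norm; exact: (integrableZl _ l irl).
exact: (integrableD _ i1 (integrableD _ i2 i3)).
Qed.

(** A contraction: starting from zero data, the maximum of |U| is at most half that of |W| and
    conversely, so both are zero. *)
Let local_uniqueness U W a b : real_solution p q r l U W -> 0 < a ->
  \int[mu]_(t in `[a, b]) h t <= 1 / 2 ->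
  forall x y, a <= x <= b -> a <= y <= b -> U x = 0 /\ W x = 0 -> U y = 0 /\ W y = 0.
Proof.
move=> [aU aW dU dW] a0 ih x y xab yab [Ux Wx].
have ab : a <= b by lra.
have [c cab hc] := loc_abs_cont_norm_max _ _ _ aU a0 ab.
have [d dab hd] := loc_abs_cont_norm_max _ _ _ aW a0 ab.
have bound f (M : R) : loc_abs_cont f -> 0 <= M -> f x = 0 ->
    {ae mu, forall z : R, a < z < b -> exists2 d, is_derive z 1 f d & `|d| <= M * h z} ->
    forall z, a <= z <= b -> `|f z| <= M / 2.
  move=> af M0 fx df z zab.
  have iM : mu.-integrable `[a, b] (EFin \o (fun z => M * h z)).
    exact: (integrableZl _ M (integrable_h a b a0)).
  have := osc_le_integral f (fun z => M * h z) a b af a0 iM _ df x z xab zab.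
  rewrite fx subr0 RintegralZl//; last exact: integrable_h.
  move=> H; apply: (le_trans (H _)).
    by move=> t /andP[ta _]; rewrite mulr_ge0// h_ge0//; lra.
  by rewrite ler_wpM2l//; lra.
have hU := bound U `|W d| aU (normr_ge0 _) Ux.
have hW := bound W `|U c| aW (normr_ge0 _) Wx.
have {}hU : forall z, a <= z <= b -> `|U z| <= `|W d| / 2.
  apply: hU; move: dU; apply: ae_impl => z Uz /andP[az zb].
  have z0 : 0 < z by lra.
  exists (W z / p z); first exact: Uz.
  case: coef => p0 _ _ _ _; have pz := p0 z z0.
  rewrite normrM (gtr0_norm (_ : 0 < (p z)^-1)) ?invr_gt0//.
  apply: ler_pM => //; first by rewrite invr_ge0 ltW.
    by apply: hd; lra.
  by rewrite /h lerDl addr_ge0.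
have {}hW : forall z, a <= z <= b -> `|W z| <= `|U c| / 2.
  apply: hW; move: dW; apply: ae_impl => z Wz /andP[az zb].
  have z0 : 0 < z by lra.
  exists ((q z - l * r z) * U z); first exact: Wz.
  case: coef => p0 _ _ _ _; have pz := p0 z z0.
  rewrite normrM mulrC; apply: ler_pM => //; first by apply: hc; lra.
  rewrite (le_trans (ler_normB _ _))// /h lerDr invr_ge0 ltW//.
have := hU c cab; have := hW d dab.
have := normr_ge0 (U c); have := normr_ge0 (W d) => ? ? ? ?.
have Wd0 : `|W d| = 0 by lra.
have Uc0 : `|U c| = 0 by lra.
split; apply/eqP; rewrite -normr_eq0 eq_le normr_ge0 andbT.
  by have := hU y yab; lra.
by have := hW y yab; lra.
Qed.

Lemma real_solution_eq0 U W x y : real_solution p q r l U W -> 0 < x -> 0 < y ->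
  U x = 0 /\ W x = 0 -> U y = 0 /\ W y = 0.
Proof.
move=> sol x0 y0.
(* Absolute continuity of the integral of [h] yields one [d] for all of [a, b], so zero data pass in
   both directions across any step shorter than [d]. *)
have step a b : 0 < a -> a <= b -> exists2 d, 0 < d & forall s t,
    a <= s -> s <= t -> t <= b -> t - s < d ->
    (U s = 0 /\ W s = 0 <-> U t = 0 /\ W t = 0).
  move=> a0 ab.
  have ik : mu.-integrable setT (EFin \o (h \_ `[a, b])).
    rewrite -restrict_EFin; apply/integrable_restrict => //.
    by rewrite setTI; exact: integrable_h.
  have half : (0 : R) < 1 / 2 by lra.
  have [d [d0 hd]] := integral_normr_continuous ik half.
  exists d => // s t as_ st tb std.
  have sub z : s <= z <= t -> a <= z <= b by lra.
  have small : \int[mu]_(z in `[s, t]) h z <= 1 / 2.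
    have mst : (mu `[s, t] < d%:E)%E.
      rewrite lebesgue_measure_itv/= lte_fin.
      by have [_|ts] := ltP s t; rewrite ?lte_fin// -EFinB lte_fin.
    apply/ltW; have := hd _ (measurable_itv _) mst; apply: le_lt_trans.
    rewrite le_eqVlt; apply/orP; left; apply/eqP.
    apply: eq_Rintegral => z; rewrite inE/= in_itv/= => zst.
    have zab := sub z zst.
    rewrite patchE mem_set/= ?in_itv//= ger0_norm// h_ge0//; lra.
  have lu := local_uniqueness U W s t sol (lt_le_trans a0 as_) small.
  by split; apply: lu; rewrite lexx ?st.
have [xy|/ltW yx] := leP x y => Px.
  apply: (real_induction _ x y (fun t => U t = 0 /\ W t = 0) xy Px) => t tab.
  have [d d0 hd] := step x y x0 xy.
  exists (d / 2); first by lra.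
  by move=> s z xs st tz zy ds zd; exact: (hd s z ltac:(lra) ltac:(lra) ltac:(lra) ltac:(lra)).1.
(* Real induction only moves to the right. For y < x it therefore carries non-vanishing from [y] up
   to [x], contradicting the zero data there. *)
apply: contrapT => Py.
apply: (real_induction _ y x (fun t => ~ (U t = 0 /\ W t = 0)) yx Py) => // t tab.
have [d d0 hd] := step y x y0 yx.
exists (d / 2); first by lra.
move=> s z xs st tz zy ds zd ns nz; apply: ns.
exact: (hd s z ltac:(lra) ltac:(lra) ltac:(lra) ltac:(lra)).2 nz.
Qed.

End uniqueness.

(** * Oscillation and monotonicity on a single window *)

Section window.
Context {R : realType} (p q r : R -> R) (l : R).
Hypothesis coef : sl_coefficients p q r.
Local Notation mu := (@lebesgue_measure R).
Implicit Types (U W : R -> R).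
Variables (x rm rM Q M : R).
Hypothesis x1 : 1 < x.
Local Notation I := `[x - 1, x + 1]%classic.
Hypothesis rm0 : 0 < rm.
Hypothesis r_bounds : forall y, x - 1 <= y <= x + 1 -> rm <= r y <= rM.
Hypothesis ik : mu.-integrable I (EFin \o (fun y => (q y / r y - l) ^+ 2)).
Hypothesis kQ : \int[mu]_(y in I) ((q y / r y - l) ^+ 2) <= Q.
Hypothesis M0 : 0 <= M.
(** What the bound on P^(-2) times the integral of r^(-2) becomes once r <= rM is inserted; 2 is the
    length of the window. *)
Hypothesis PM : 2 <= M * Pint p x ^+ 2 * rM ^+ 2.
Hypothesis P0 : 0 < Pint p x.

Let a0 : 0 < x - 1. Proof. by have := x1; lra. Qed.
Let rM0 : 0 < rM.
Proof. by have /andP[h1 h2] := r_bounds x ltac:(lra); apply: lt_le_trans rm0 (le_trans h1 h2). Qed.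
Let Q0 : 0 <= Q.
Proof. by apply: le_trans kQ; apply: Rintegral_ge0 => y _; exact: sqr_ge0. Qed.

Let N2 U := \int[mu]_(y in I) (U y ^+ 2 * r y).

Let r_ge0 y : x - 1 <= y <= x + 1 -> 0 <= r y.
Proof. by have := rm0; move=> ? /r_bounds; lra. Qed.

Let N2_ge0 U : 0 <= N2 U.
Proof.
apply: Rintegral_ge0 => y; rewrite /= in_itv/= => /r_ge0 ry.
by rewrite mulr_ge0 ?sqr_ge0.
Qed.

(** Since W' = (q / r - l)(r U) and (r U)^2 <= rM U^2 r, this is Cauchy-Schwarz with the factor [rM]
    left over. *)
Let window_oscillation U W y z : real_solution p q r l U W ->
  x - 1 <= y <= x + 1 -> x - 1 <= z <= x + 1 ->
  (W z - W y) ^+ 2 <= Q * rM * N2 U.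
Proof.
have [hx1 hrm0] := (x1, rm0).
move=> [aU aW dU dW] yI zI; rewrite -real_normK ?num_real//.
have iU : mu.-integrable I (EFin \o (fun y => U y ^+ 2 * r y)).
  by apply: integrable_square_weight => //; case: coef.
(* The halves match the weights s / 2 and 1 / (2 s) in A B <= s A^2 / 2 + B^2 / (2 s), of which [k]
   below is the integrand. *)
have -> : Q * rM * N2 U = 4 * (Q / 2) * (rM * N2 U / 2) by field.
apply: sqr_le_of_weighted => //; first by rewrite divr_ge0.
  by rewrite divr_ge0// mulr_ge0// ltW.
move=> s s0.
pose k y := s / 2 * (q y / r y - l) ^+ 2 + rM / (2 * s) * (U y ^+ 2 * r y).
have s2 : 0 < s / 2 by lra.
have rs : 0 < rM / (2 * s) by rewrite divr_gt0// mulr_gt0.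
have i1 : mu.-integrable I (EFin \o (fun y => s / 2 * (q y / r y - l) ^+ 2)).
  exact: (integrableZl _ (s / 2) ik).
have i2 : mu.-integrable I (EFin \o (fun y => rM / (2 * s) * (U y ^+ 2 * r y))).
  exact: (integrableZl _ (rM / (2 * s)) iU).
have ikk : mu.-integrable I (EFin \o k) by exact: (integrableD _ i1 i2).
apply: (@le_trans _ _ (\int[mu]_(y in I) k y)).
  apply: osc_le_integral => //.
    move=> t tI; apply: addr_ge0; apply: mulr_ge0; rewrite ?sqr_ge0 ?(ltW s2) ?(ltW rs)//.
    by rewrite mulr_ge0 ?sqr_ge0 ?r_ge0.
  move: dW; apply: ae_impl => t Wt tI.
  have t0 : 0 < t by lra.
  have tI' : x - 1 <= t <= x + 1 by lra.
  exists ((q t - l * r t) * U t); first exact: Wt.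
  have /andP[rmt rMt] := r_bounds t tI'.
  have rt : 0 < r t by lra.
  have -> : (q t - l * r t) * U t = (q t / r t - l) * (r t * U t).
    by field; rewrite gt_eqF.
  rewrite /k; set K := q t / r t - l.
  have h : rM / (2 * s) * (U t ^+ 2 * r t) >= (r t * U t) ^+ 2 / (2 * s).
    have -> : rM / (2 * s) * (U t ^+ 2 * r t) = (rM * r t * U t ^+ 2) / (2 * s) by ring.
    rewrite ler_pM2r; last by rewrite invr_gt0 mulr_gt0.
    rewrite exprMn ler_wpM2r ?sqr_ge0// expr2 ler_wpM2r//; lra.
  apply: le_trans (lerD (lexx _) h).
  rewrite normrM -(real_normK (num_real K)) -(real_normK (num_real (r t * U t))).
  set A := `|K|; set B := `|_|.
  rewrite -subr_ge0.
  have -> : s / 2 * A ^+ 2 + B ^+ 2 / (2 * s) - A * B = (s * A - B) ^+ 2 / (2 * s).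
    by field; rewrite gt_eqF.
  by rewrite divr_ge0 ?sqr_ge0// mulr_ge0// ltW.
rewrite RintegralD//.
rewrite RintegralZl// RintegralZl//.
have -> : rM * N2 U / 2 / s = rM / (2 * s) * N2 U by field; rewrite gt_eqF.
rewrite lerD2r mulrA [s * Q / 2]mulrAC ler_wpM2l//; exact: ltW.
Qed.

Let N2_ge_const U c a b : loc_abs_cont U -> x - 1 <= a -> a <= b -> b <= x + 1 -> 0 <= c ->
  (forall y, a <= y <= b -> c <= `|U y|) -> (b - a) * (c ^+ 2 * rm) <= N2 U.
Proof.
have [hx1 hrm0] := (x1, rm0).
move=> aU xa ab bx c0 cU.
have iU : mu.-integrable I (EFin \o (fun y => U y ^+ 2 * r y)).
  by apply: integrable_square_weight => //; case: coef.
have sub : `[a, b]%classic `<=` I.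
  by move=> z; rewrite /= !in_itv/=; lra.
rewrite -lee_fin /N2 /Rintegral fineK; last exact: integrable_fin_num.
apply: (@le_trans _ _ (\int[mu]_(y in `[a, b]) (U y ^+ 2 * r y)%:E)%E); last first.
  apply: ge0_subset_integral => //; first by case/integrableP : iU.
  by move=> y; rewrite /= in_itv/= => /r_ge0 ry; rewrite lee_fin mulr_ge0 ?sqr_ge0.
have -> : ((b - a) * (c ^+ 2 * rm))%:E = (\int[mu]_(y in `[a, b]) (c ^+ 2 * rm)%:E)%E.
  rewrite integral_cst//= lebesgue_measure_itv/= lte_fin.
  have [ab'|ba] := ltP a b; first by rewrite -EFinB -EFinM mulrC.
  by rewrite mule0 (_ : b - a = 0) ?mul0r//; lra.
apply: ge0_le_integral => //.
- by move=> y _; rewrite lee_fin mulr_ge0 ?sqr_ge0// ltW.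
- case/integrableP : iU => mU _; exact: measurable_funS mU.
- move=> y; rewrite /= in_itv/= => yab; rewrite lee_fin.
  have := r_bounds y ltac:(lra) => /andP[rmy _].
  apply: ler_pM => //; [exact: sqr_ge0|exact: ltW|].
  by rewrite -(real_normK (num_real (U y))) lerXn2r ?nnegrE// cU.
Qed.

(* If [W] stays away from [0] then [U] is monotone across the central half of
   the window, so that it is large on one of the two outer quarters. *)
Let window_monotone U W c : real_solution p q r l U W -> 0 < c ->
  (forall y, x - 1 <= y <= x + 1 -> c <= W y) ->
  rm * c ^+ 2 <= 4 * M * rM ^+ 2 * N2 U.
Proof.
have [hx1 hrm0] := (x1, rm0).
move=> [aU aW dU dW] c0 cW; case: coef => p0 _ ip _ _.
have incr s t : x - 1 <= s -> s <= t -> t <= x + 1 ->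
    c * \int[mu]_(y in `[s, t]) (p y)^-1 <= U t - U s.
  move=> xs st tx.
  have is_ : mu.-integrable `[s, t] (EFin \o (fun y => (p y)^-1)).
    by apply: locally_integrable_itv => //; lra.
  rewrite -RintegralZl//; apply: abs_cont_ge_integral => //.
  - by apply: aU => //; lra.
  - exact: (integrableZl _ c is_).
  - move: dU; apply: ae_impl => y Uy /andP[sy yt].
    have y0 : 0 < y by lra.
    exists (W y / p y); first exact: Uy.
    by rewrite ler_wpM2r ?invr_ge0 ?(ltW (p0 y y0))//; apply: cW; lra.
have mono s t : x - 1 <= s -> s <= t -> t <= x + 1 -> U s <= U t.
  move=> xs st tx; have := incr s t xs st tx.
  have : 0 <= c * \int[mu]_(y in `[s, t]) (p y)^-1.
    rewrite mulr_ge0 ?(ltW c0)//; apply: Rintegral_ge0 => y.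
    by rewrite /= in_itv/= => yst; rewrite invr_ge0 ltW// p0//; lra.
  lra.
have jump := incr (x - 1 / 2) (x + 1 / 2) ltac:(lra) ltac:(lra) ltac:(lra).
rewrite -/(Pint p x) in jump.
pose d := c * Pint p x / 2.
have d0 : 0 < d by rewrite divr_gt0// mulr_gt0.
have Nd : (1 / 2) * (d ^+ 2 * rm) <= N2 U.
  have [Ux|Ux] := leP d (U (x + 1 / 2)).
    have := N2_ge_const U d (x + 1 / 2) (x + 1) aU.
    have -> : x + 1 - (x + 1 / 2) = 1 / 2 by lra.
    apply; try lra.
    move=> y yI; have := mono (x + 1 / 2) y ltac:(lra) ltac:(lra) ltac:(lra).
    by have := ler_norm (U y); lra.
  have := N2_ge_const U d (x - 1) (x - 1 / 2) aU.
  have -> : x - 1 / 2 - (x - 1) = 1 / 2 by lra.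
  apply; try lra.
  move=> y yI; have := mono y (x - 1 / 2) ltac:(lra) ltac:(lra) ltac:(lra).
  by have := ler_norm (- U y); rewrite normrN; move: Ux jump; rewrite /d; lra.
(* By [Nd], [N2 U] is at least c^2 P^2 rm / 8, and [PM] replaces P^2 by 2 / (M rM^2); the quotient 8
   / 2 is the constant 4. *)
have e1 : rm * c ^+ 2 * 2 <= rm * c ^+ 2 * (M * Pint p x ^+ 2 * rM ^+ 2).
  by rewrite ler_wpM2l// mulr_ge0 ?sqr_ge0 ?ltW.
have e2 : M * rM ^+ 2 * (1 / 2 * (d ^+ 2 * rm)) <= M * rM ^+ 2 * N2 U.
  by rewrite ler_wpM2l// mulr_ge0 ?sqr_ge0.
have e3 : M * rM ^+ 2 * (1 / 2 * (d ^+ 2 * rm)) =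
    rm * c ^+ 2 * (M * Pint p x ^+ 2 * rM ^+ 2) / 8 by rewrite /d; field.
lra.
Qed.

(** The constant 9 is the square in |W y| <= 3 D, valid when |W x| <= 2 D. Otherwise |W| stays above
    c = |W x| / 2 and below 3 c, and 36 is 9 times the 4 of [window_monotone]. *)
Lemma window_bound U W y : real_solution p q r l U W -> x - 1 <= y <= x + 1 ->
  rm * W y ^+ 2 <= (9 * Q * rM * rm + 36 * M * rM ^+ 2) * N2 U.
Proof.
have [hx1 hrm0] := (x1, rm0).
move=> sol yI; pose D := Num.sqrt (Q * rM * N2 U).
have QN0 : 0 <= Q * rM * N2 U by rewrite !mulr_ge0 ?(ltW rM0).
have D0 : 0 <= D by exact: sqrtr_ge0.
have DE : D ^+ 2 = Q * rM * N2 U by rewrite sqr_sqrtr.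
have osc z t : x - 1 <= z <= x + 1 -> x - 1 <= t <= x + 1 -> `|W t - W z| <= D.
  move=> zI tI; rewrite -sqrtr_sqr ler_sqrt//.
  exact: window_oscillation.
have xI : x - 1 <= x <= x + 1 by lra.
have := osc x y xI yI; rewrite ler_norml => /andP[Wy1 Wy2].
have MN0 : 0 <= M * rM ^+ 2 * N2 U by rewrite !mulr_ge0 ?(ltW rM0).
have [small|big] := leP `|W x| (2 * D).
  have : `|W y| <= 3 * D.
    by move: small; rewrite !ler_norml => /andP[? ?]; apply/andP; split; lra.
  rewrite -[W y ^+ 2](real_normK (num_real _)) => WD.
  have : `|W y| ^+ 2 <= (3 * D) ^+ 2 by rewrite lerXn2r ?nnegrE// mulr_ge0.
  rewrite exprMn DE => h.
  have : rm * `|W y| ^+ 2 <= rm * (3 ^+ 2 * (Q * rM * N2 U)).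
    by rewrite ler_wpM2l// ltW.
  lra.
have QM0 : 0 <= Q * rM * rm * N2 U by rewrite !mulr_ge0 ?(ltW rM0) ?(ltW rm0).
have W0 : 0 < `|W x| by lra.
have c0 : 0 < `|W x| / 2 by lra.
have key : rm * (`|W x| / 2) ^+ 2 <= 4 * M * rM ^+ 2 * N2 U.
  have [Wx|Wx] := leP 0 (W x).
    apply: window_monotone sol c0 _ => t tI.
    have := osc x t xI tI; rewrite ler_norml => /andP[? ?].
    by move: big; rewrite (ger0_norm Wx); lra.
  have solN := real_solutionZ p q r l (-1) U W sol.
  have := window_monotone _ _ _ solN c0 => /(_ _)/=.
  rewrite (_ : N2 _ = N2 U); last first.
    by apply: eq_Rintegral => t _; rewrite mulN1r sqrrN.
  apply=> t tI.
  have := osc x t xI tI; rewrite ler_norml => /andP[? ?].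
  by move: big; rewrite (ltr0_norm Wx); lra.
have Wy : `|W y| <= 3 * (`|W x| / 2).
  have := ler_normD (W y - W x) (W x); rewrite subrK.
  by have := osc x y xI yI; lra.
have Wy2' : rm * `|W y| ^+ 2 <= rm * (3 * (`|W x| / 2)) ^+ 2.
  by rewrite ler_wpM2l ?(ltW rm0)// lerXn2r ?nnegrE// ltW// mulr_gt0.
rewrite -[W y ^+ 2](real_normK (num_real _)).
move: Wy2'; rewrite (exprMn 2 3); lra.
Qed.

End window.

Lemma measurable_inv_pos (R : realType) (f : R -> R) :
  measurable_fun (`]0, +oo[%classic : set R) f -> (forall x, 0 < x -> 0 < f x) ->
  measurable_fun (`]0, +oo[%classic : set R) (fun x => (f x)^-1).
Proof.
move=> mf f0.
have mp : measurable_fun (`]0, +oo[%classic : set R) (fun x => powR (f x) (-1)).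
  by apply: (@measurableT_comp _ _ _ _ _ _ (@powR R ^~ (-1))) => //; exact: measurable_powR.
apply: eq_measurable_fun mp => x; rewrite inE/= in_itv/= andbT => x0.
by rewrite powR_inv1// ltW// f0.
Qed.

(** * Summing pointwise window bounds *)

Section window_sums.
Context {R : realType}.
Local Notation mu := (@lebesgue_measure R).
Implicit Types (f g : R -> \bar R).
Local Notation halfline := (`]0%R, +oo[%classic : set R).

(** The windows ]n, n + 3] overlap threefold. Keeping three integrals on the right avoids counting
    overlaps: in the step from n to n + 1, the integral up to n absorbs the new window and becomes
    the one up to n + 3. *)
Lemma integral_windows f g (K : R) : 0 <= K ->
  measurable_fun halfline f -> measurable_fun halfline g ->
  (forall x, 0 < x -> (0 <= f x)%E) -> (forall x, 0 < x -> (0 <= g x)%E) ->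
  (forall (n : nat) y, n%:R < y <= n%:R + 1 ->
     (g y <= K%:E * \int[mu]_(x in `]n%:R, (n%:R + 3)%R]) f x)%E) ->
  forall n : nat, (\int[mu]_(x in `]0%R, n%:R]) g x <=
    K%:E * (\int[mu]_(x in `]0%R, n%:R]) f x + \int[mu]_(x in `]0%R, (n%:R + 1)%R]) f x
      + \int[mu]_(x in `]0%R, (n%:R + 2)%R]) f x))%E.
Proof.
move=> K0 mf mg f0 g0 win.
have pos (a b x : R) : 0 <= a -> `]a, b]%classic x -> 0 < x.
  by move=> a_ge0; rewrite /= in_itv/= => /andP[? _]; lra.
have mi (h : R -> \bar R) (a b : R) : measurable_fun halfline h -> 0 <= a ->
    measurable_fun `]a, b]%classic h.
  by move=> mh a_ge0; apply: measurable_funS mh => // x /(pos _ _ _ a_ge0);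
  rewrite /= in_itv/= andbT.
have split_int (h : R -> \bar R) (a b : R) : measurable_fun halfline h ->
    (forall x, 0 < x -> (0 <= h x)%E) -> 0 <= a -> a <= b ->
    (\int[mu]_(x in `]0%R, b]) h x =
     \int[mu]_(x in `]0%R, a]) h x + \int[mu]_(x in `]a, b]) h x)%E.
  move=> mh h0 a_ge0 ab.
  have E : `]0, b]%classic = `]0, a]%classic `|` `]a, b]%classic.
    by rewrite -itv_bndbnd_setU// bnd_simp.
  rewrite [in LHS]E ge0_integral_setU//.
  - by rewrite -E; exact: mi.
  - by move=> x; rewrite -E => /(pos _ _ _ (lexx 0)); exact: h0.
  - apply/disj_setPS => x [/=]; rewrite !in_itv/= => /andP[_ xa] /andP[ax _]; lra.
have int0 (h : R -> \bar R) (a b : R) : (forall x, 0 < x -> (0 <= h x)%E) -> 0 <= a ->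
    (0 <= \int[mu]_(x in `]a, b]) h x)%E.
  by move=> h0 a_ge0; apply: integral_ge0 => x /(pos _ _ _ a_ge0); exact: h0.
elim=> [|n IH].
  have -> : (\int[mu]_(x in `]0%R, 0%:R]) g x = 0)%E.
    by rewrite set_itv_ge ?bnd_simp// integral_set0.
  apply: mule_ge0; first by rewrite lee_fin.
  by apply: adde_ge0; first apply: adde_ge0; exact: int0.
have n0 : 0 <= n%:R :> R by [].
rewrite -natr1 (split_int g n%:R)//; last by lra.
have step : (\int[mu]_(x in `]n%:R, (n%:R + 1)%R]) g x <=
    K%:E * \int[mu]_(x in `]n%:R, (n%:R + 3)%R]) f x)%E.
  apply: (@le_trans _ _ (\int[mu]_(x in `]n%:R, (n%:R + 1)%R])
     (K%:E * \int[mu]_(x in `]n%:R, (n%:R + 3)%R]) f x))%E).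
    apply: ge0_le_integral => //.
    - by move=> x /(pos _ _ _ n0); exact: g0.
    - exact: mi.
    - by move=> x; rewrite /= in_itv/=; exact: win.
  rewrite integral_cst//= lebesgue_measure_itv/= lte_fin ltrDl ltr01.
  by rewrite -EFinB addrAC subrr add0r mule1.
apply: le_trans (leeD IH step) _.
have -> : n%:R + 1 + 1 = n%:R + 2 :> R by lra.
have -> : n%:R + 1 + 2 = n%:R + 3 :> R by lra.
rewrite -ge0_muleDr; [|by apply: adde_ge0; first apply: adde_ge0; exact: int0|exact: int0].
rewrite (split_int f n%:R (n%:R + 3))//; last by lra.
by rewrite addeA (addeC (_ + _)%E (\int[mu]_(x in `]0%R, n%:R]) f x)%E) !addeA.
Qed.

End window_sums.

Lemma normc_sqr (R : realType) (z : R[i]) :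
  Normc.normc z ^+ 2 = complex.Re z ^+ 2 + complex.Im z ^+ 2.
Proof. by case: z => a b /=; rewrite sqr_sqrtr// addr_ge0 ?sqr_ge0. Qed.

(** * Real and imaginary parts of a solution *)

Section solution_components.
Context {R : realType} (p q r : R -> R) (l : R).
Hypothesis coef : sl_coefficients p q r.
Local Notation mu := (@lebesgue_measure R).
Implicit Types (u w : R -> R[i]).

(** Two representatives agree where [u] has its derivative, hence a.e., hence everywhere on the
    half-line by continuity. This transfers the estimate to whichever representative is given. *)
Lemma quasi_derivative_unique u w1 w2 :
  quasi_derivative p u w1 -> quasi_derivative p u w2 ->
  forall x, 0 < x -> w1 x = w2 x.
Proof.
move=> [[r1 i1] d1] [[r2 i2] d2].
have E : {ae mu, forall x, 0 < x -> w1 x = w2 x}.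
  move: d1 d2; apply: ae_impl2 => x h1 h2 x0.
  have [e1 [a1 b1] ->] := h1 x0; have [e2 [a2 b2] ->] := h2 x0.
  congr (_ * _); rewrite (complexE e1) (complexE e2).
  have <- : complex.Re e1 = complex.Re e2.
    by rewrite -(@derive_val _ _ _ _ _ _ _ a1) -(@derive_val _ _ _ _ _ _ _ a2).
  have <- // : complex.Im e1 = complex.Im e2.
  by rewrite -(@derive_val _ _ _ _ _ _ _ b1) -(@derive_val _ _ _ _ _ _ _ b2).
have H (f1 f2 : R -> R) : loc_abs_cont f1 -> loc_abs_cont f2 ->
    {ae mu, forall x, 0 < x -> f1 x = f2 x} -> forall x, 0 < x -> f1 x = f2 x.
  move=> a1 a2 e12 x x0.
  have := loc_abs_cont_ae_eq0 (fun x => f1 x + -1 * f2 x).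
  move=> /(_ (loc_abs_contD _ _ a1 (loc_abs_contZ (-1) _ a2))) h.
  suff : f1 x + -1 * f2 x = 0 by lra.
  apply: h => //; move: e12; apply: ae_impl => y e y0.
  by rewrite e//; lra.
move=> x x0; rewrite (complexE (w1 x)) (complexE (w2 x)).
rewrite (H _ _ r1 r2 _ x x0); last by move: E; apply: ae_impl => y e y0; rewrite e.
by rewrite (H _ _ i1 i2 _ x x0)//; move: E; apply: ae_impl => y e y0; rewrite e.
Qed.

Lemma solution_components u : is_solution p q r l%:C%C u ->
  exists w, [/\ quasi_derivative p u w,
    real_solution p q r l (fun x => complex.Re (u x)) (fun x => complex.Re (w x)) &
    real_solution p q r l (fun x => complex.Im (u x)) (fun x => complex.Im (w x))].
Proof.
move=> [[ru iu] [w [[rw iw] dw] dw']]; case: coef => p0 _ _ _ _.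
exists w; split=> //; split=> //.
- move: dw; apply: ae_impl => x h x0; have [d [dr di] ->] := h x0.
  apply: is_derive_eq dr _; case: d {di} => a b /=.
  by field; rewrite gt_eqF// p0.
- move: dw'; apply: ae_impl => x h x0; have [d [dr di] E] := h x0.
  apply: is_derive_eq dr _; move: E {di}; case: d => a b; case: (u x) => c d /=.
  by move=> [] /= E _; lra.
- move: dw; apply: ae_impl => x h x0; have [d [dr di] ->] := h x0.
  apply: is_derive_eq di _; case: d {dr} => a b /=.
  by field; rewrite gt_eqF// p0.
- move: dw'; apply: ae_impl => x h x0; have [d [dr di] E] := h x0.
  apply: is_derive_eq di _; move: E {dr}; case: d => a b; case: (u x) => c d /=.
  by move=> [] /= _ E; lra.
Qed.

End solution_components.

(** * A window constant uniform in the centre *)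

Section window_estimate.
Context {R : realType} (p q r : R -> R) (l : R).
Hypothesis coef : sl_coefficients p q r.
Local Notation mu := (@lebesgue_measure R).

(** A vanishing integral would make the positive function 1 / p zero a.e. Positivity matters for
    [hP] as well: at P = 0 the inverse would take the default value 0 and the bound would be
    empty. *)
Lemma Pint_gt0 x : 1 < x -> 0 < Pint p x.
Proof.
move=> x1; case: coef => p0 _ ip _ _.
have a0 : 0 < x - 1 / 2 by lra.
have pos y : x - 1 / 2 <= y <= x + 1 / 2 -> 0 < (p y)^-1.
  by move=> yI; rewrite invr_gt0 p0//; lra.
have iI := locally_integrable_itv _ (x - 1 / 2) (x + 1 / 2) ip a0.
rewrite lt_neqAle; apply/andP; split; last first.
  by apply: Rintegral_ge0 => y; rewrite /= in_itv/= => /pos/ltW.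
apply/eqP => P0.
have E : (\int[mu]_(y in `[(x - 1 / 2)%R, (x + 1 / 2)%R]) `|((p y)^-1)%:E| = 0)%E.
  transitivity (\int[mu]_(y in `[(x - 1 / 2)%R, (x + 1 / 2)%R]) ((p y)^-1)%:E)%E.
    apply: eq_integral => y; rewrite inE/= in_itv/= => /pos py.
    by rewrite ger0_norm// ltW.
  by rewrite -[LHS]fineK; [move: P0; rewrite /Pint /Rintegral => <-|exact: integrable_fin_num].
have mI : measurable_fun `[x - 1 / 2, x + 1 / 2]%classic (EFin \o (fun y => (p y)^-1)).
  by case/integrableP : iI.
have := (ae_eq_integral_abs mu (measurable_itv _) mI).1 E => ae0.
have [|y /andP[xy yx]] := ae_dense _ x (1 / 2) ae0; first by lra.
have yI : x - 1 / 2 <= y <= x + 1 / 2 by lra.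
rewrite /= in_itv/= => /(_ yI) [] py; have := pos y yI; lra.
Qed.

Hypothesis hr : forall x : R, 1 < x -> (0 < rminus r x /\ rplus r x < +oo)%E.
Hypothesis hgamma : bounded_gt1 (fun x => (gamma r x)%:E).
Hypothesis hP : bounded_gt1 (fun x =>
  (((Pint p x) ^+ 2)^-1)%:E *
  \int[mu]_(y in `[(x - 1)%R, (x + 1)%R]) (((r y) ^+ 2)^-1)%:E)%E.
Hypothesis hq : bounded_gt1 (fun x =>
  \int[mu]_(y in `[(x - 1)%R, (x + 1)%R]) (`|q y / r y - l| ^+ 2)%:E)%E.

(** [gamma] applies [fine] to extended reals; [hr] and the value [r x] between the two bounds
    exclude the infinite cases, in which [fine] returns 0. *)
Lemma rminus_rplus x : 1 < x -> exists rm rM : R,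
  [/\ 0 < rm, gamma r x = rM / rm & forall y, x - 1 <= y <= x + 1 -> rm <= r y <= rM].
Proof.
move=> x1; have [m0 Moo] := hr x x1.
have lo y : x - 1 <= y <= x + 1 -> (rminus r x <= (r y)%:E)%E.
  by move=> yI; apply: ereal_inf_lbound; exists y; rewrite //= in_itv.
have up y : x - 1 <= y <= x + 1 -> ((r y)%:E <= rplus r x)%E.
  by move=> yI; apply: ereal_sup_ubound; exists y; rewrite //= in_itv.
have xI : x - 1 <= x <= x + 1 by lra.
have := lo x xI; have := up x xI.
rewrite /gamma; move: m0 Moo lo up.
case: (rminus r x) => [m| |] //=; case: (rplus r x) => [M| |] //=.
move=> m0 _ lo up _ _; exists m, M; split=> // y yI.
by rewrite -!lee_fin lo// up.
Qed.

Lemma window_estimate : exists2 K, 0 < K & forall U W, real_solution p q r l U W ->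
  forall x y, 1 < x -> x - 1 <= y <= x + 1 ->
  W y ^+ 2 / r y <= K * \int[mu]_(z in `[x - 1, x + 1]) (U z ^+ 2 * r z).
Proof.
case: hgamma => G0 hG; case: hP => M0 hM; case: hq => Q0 hQ.
pose G := `|G0|; pose M := `|M0|; pose Q := `|Q0|.
have [G_ge0 M_ge0 Q_ge0] : [/\ 0 <= G, 0 <= M & 0 <= Q] by rewrite /G /M /Q.
(* In [window_bound], rM <= G rm turns the right side into a multiple of rm^2; one rm cancels and
   the other is at most r y. The summand 1 makes the constant positive. *)
exists (9 * Q * G + 36 * M * G ^+ 2 + 1).
  by rewrite ltr_wpDl// addr_ge0// ?mulr_ge0// sqr_ge0.
move=> U W sol x y x1 yI.
have [rm [rM [rm0 gE rb]]] := rminus_rplus x x1.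
have a0 : 0 < x - 1 by lra.
case: (coef) => p0 r0 _ [mq _ _] lr.
have [mr _ _] := lr.
have sub : `[x - 1, x + 1]%classic `<=` (`]0, +oo[%classic : set R).
  by move=> z; rewrite /= !in_itv/= andbT => /andP[? _]; lra.
have mir := measurable_inv_pos R r mr r0.
have rM0 : 0 < rM by have := rb y yI; lra.
have rMG : rM <= G * rm.
  rewrite -ler_pdivrMr// -gE; apply: le_trans (ler_norm G0).
  have := hG x x1; rewrite /= lee_fin; exact/le_trans/ler_norm.
have mk : measurable_fun (`[x - 1, x + 1]%classic : set R) (fun y => (q y / r y - l) ^+ 2).
  apply: measurable_funX; apply: measurable_funB => //.
  by apply: measurable_funM; [apply: measurable_funS mq|apply: measurable_funS mir].
have kE : (\int[mu]_(y in `[(x - 1)%R, (x + 1)%R]) (`|q y / r y - l| ^+ 2)%:E =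
    \int[mu]_(y in `[(x - 1)%R, (x + 1)%R]) ((q y / r y - l) ^+ 2)%:E)%E.
  by apply: eq_integral => z _; rewrite real_normK ?num_real.
have k0 : (0 <= \int[mu]_(y in `[(x - 1)%R, (x + 1)%R]) ((q y / r y - l) ^+ 2)%:E)%E.
  by apply: integral_ge0 => z _; rewrite lee_fin sqr_ge0.
have kQ : (\int[mu]_(y in `[(x - 1)%R, (x + 1)%R]) ((q y / r y - l) ^+ 2)%:E <= Q%:E)%E.
  have := hQ x x1; rewrite kE gee0_abs// => /le_trans; apply.
  by rewrite lee_fin ler_norm.
(* [hq] bounds an extended-real integral, so integrability is part of what it provides. *)
have ik : mu.-integrable `[x - 1, x + 1] (EFin \o (fun y => (q y / r y - l) ^+ 2)).
  apply/integrableP; split; first exact/measurable_EFinP.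
  apply: le_lt_trans (ltry Q); apply: le_trans kQ.
  rewrite le_eqVlt; apply/orP; left; apply/eqP; apply: eq_integral => z _ /=.
  by rewrite ger0_norm// sqr_ge0.
have kQ' : \int[mu]_(y in `[x - 1, x + 1]) ((q y / r y - l) ^+ 2) <= Q.
  by rewrite -lee_fin /Rintegral fineK//; exact: integrable_fin_num.
have P0 := Pint_gt0 x x1.
have PM : 2 <= M * Pint p x ^+ 2 * rM ^+ 2.
  have c0 : (0 <= ((Pint p x ^+ 2)^-1)%:E)%E by rewrite lee_fin invr_ge0 sqr_ge0.
  have : ((2 / rM ^+ 2)%:E <=
      \int[mu]_(y in `[(x - 1)%R, (x + 1)%R]) ((r y ^+ 2)^-1)%:E)%E.
    have -> : (2 / rM ^+ 2)%:E =
        (\int[mu]_(y in `[(x - 1)%R, (x + 1)%R]) ((rM ^+ 2)^-1)%:E)%E.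
      rewrite integral_cst//= lebesgue_measure_itv/= lte_fin.
      rewrite (_ : x - 1 < x + 1 = true); last by apply/idP; lra.
      by rewrite -EFinB -EFinM; congr EFin; field; rewrite gt_eqF.
    apply: ge0_le_integral => //.
    - by move=> z _; rewrite lee_fin invr_ge0 sqr_ge0.
    - apply/measurable_EFinP.
      have := measurable_funX 2 (measurable_funS (measurable_itv _) sub mir).
      by apply: eq_measurable_fun => z _; rewrite exprVn.
    - move=> z; rewrite /= in_itv/= => zI; rewrite lee_fin.
      have /andP[zm zM] := rb z zI; have z0 : 0 < r z by lra.
      rewrite lef_pV2 ?posrE ?exprn_gt0// lerXn2r ?nnegrE//; exact: ltW.
  move=> /(lee_wpmul2l c0) h.
  have := le_trans h (le_trans (lee_abs _) (hM x x1)).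
  rewrite -EFinM lee_fin => {}h.
  have hh : (Pint p x ^+ 2)^-1 * (2 / rM ^+ 2) <= M by exact: le_trans h (ler_norm _).
  move: hh; rewrite mulrA ler_pdivrMr ?exprn_gt0//.
  by rewrite mulrC ler_pdivrMr ?exprn_gt0// mulrAC.
have := window_bound p q r l coef x rm rM Q M x1 rm0 rb ik kQ' M_ge0 PM P0 U W y sol yI.
set N := \int[mu]_(z in _) _ => bound.
have N0 : 0 <= N.
  apply: Rintegral_ge0 => z; rewrite /= in_itv/= => zI.
  by rewrite mulr_ge0 ?sqr_ge0//; have := rb z zI; lra.
have ry := rb y yI.
have ry0 : 0 < r y by lra.
rewrite ler_pdivrMr//.
have QN : 0 <= Q * rm * N by rewrite !mulr_ge0 ?(ltW rm0).
have h1 : (Q * rm * N) * rM <= (Q * rm * N) * (G * rm) by rewrite ler_wpM2l.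
have rM2 : rM ^+ 2 <= (G * rm) ^+ 2 by rewrite lerXn2r ?nnegrE ?mulr_ge0 ?(ltW rM0) ?(ltW rm0).
have MN : 0 <= M * N by rewrite mulr_ge0.
have h2 : (M * N) * rM ^+ 2 <= (M * N) * (G * rm) ^+ 2 by rewrite ler_wpM2l.
pose K := 9 * Q * G + 36 * M * G ^+ 2.
have K0 : 0 <= K by rewrite addr_ge0// ?mulr_ge0// sqr_ge0.
have h3 : rm * W y ^+ 2 <= rm * (K * N * rm) by rewrite /K; move: h1 h2 bound; lra.
have h4 : W y ^+ 2 <= K * N * rm by move: h3; rewrite ler_pM2l.
have KN : 0 <= K * N by rewrite mulr_ge0.
have h5 : K * N * rm <= K * N * r y by rewrite ler_wpM2l//; lra.
have h6 : 0 <= N * r y by rewrite mulr_ge0// ltW.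
rewrite -/K; lra.
Qed.

End window_estimate.

(** * Averages and the Wronskian *)

(** A neighbourhood of infinity contains its translates to the right, so the shift by [k] is lost in
    the limit superior. *)
Lemma limsup_le_scaled (R : realType) (A B : R -> \bar R) (C k : R) : 0 < C -> 0 <= k ->
  (forall x, k <= x -> (A x <= C%:E * B (x + k)%R)%E) ->
  (limsup_oo A <= C%:E * limsup_oo B)%E.
Proof.
move=> C0 k0 AB; rewrite -lee_pdivrMl//; apply: le_ereal_inf_tmp => _ [V nV <-].
rewrite lee_pdivrMl//; case: nV => M [_ hM].
apply: (@le_trans _ _ (ereal_sup (A @` `]Num.max M k, +oo[%classic))).
  apply: ereal_inf_lbound; exists `]Num.max M k, +oo[%classic => //.
  exists (Num.max M k); split; first exact: num_real.
  by move=> x; rewrite /= in_itv/= andbT.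
apply: ge_ereal_sup => _ [x + <-]; rewrite /= in_itv/= andbT gt_max => /andP[Mx kx].
apply: le_trans (AB x (ltW kx)) _; apply: lee_wpmul2l; first by rewrite lee_fin ltW.
by apply: ereal_sup_ubound; exists (x + k) => //; apply: hM; lra.
Qed.

(** * Energy integrals over (0, x) *)

Section energy.
Context {R : realType} (p q r : R -> R) (l : R).
Hypothesis coef : sl_coefficients p q r.
Local Notation mu := (@lebesgue_measure R).
Local Notation halfline := (`]0%R, +oo[%classic : set R).
Variable K : R.
Hypothesis K0 : 0 < K.
Hypothesis window : forall U W, real_solution p q r l U W ->
  forall x y, 1 < x -> x - 1 <= y <= x + 1 ->
  W y ^+ 2 / r y <= K * \int[mu]_(z in `[x - 1, x + 1]) (U z ^+ 2 * r z).

Definition complex_solution (u w : R -> R[i]) :=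
  real_solution p q r l (fun x => complex.Re (u x)) (fun x => complex.Re (w x)) /\
  real_solution p q r l (fun x => complex.Im (u x)) (fun x => complex.Im (w x)).

Implicit Types (u v w : R -> R[i]).

Let r_gt0 x : 0 < x -> 0 < r x. Proof. by case: coef => _ + _ _ _; apply. Qed.

Let measurable_r : measurable_fun halfline r.
Proof. by case: coef => _ _ _ _ [? _ _]. Qed.

Lemma measurable_density u w : complex_solution u w ->
  measurable_fun halfline (fun x => (Normc.normc (u x) ^+ 2 * r x)%:E) /\
  measurable_fun halfline (fun x => (Normc.normc (w x) ^+ 2 / r x)%:E).
Proof.
move=> [[ru rw _ _] [iu iw _ _]].
have m (f : R -> R[i]) : loc_abs_cont (fun x => complex.Re (f x)) ->
    loc_abs_cont (fun x => complex.Im (f x)) ->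
    measurable_fun halfline (fun x => Normc.normc (f x) ^+ 2).
  move=> rf jf.
  have := measurable_funD (measurable_funX 2 (loc_abs_cont_measurable _ rf))
    (measurable_funX 2 (loc_abs_cont_measurable _ jf)).
  by apply: eq_measurable_fun => x _; rewrite normc_sqr.
split; apply/measurable_EFinP; apply: measurable_funM => //; try exact: m.
by apply: measurable_inv_pos.
Qed.

Let density_u_ge0 u x : 0 < x -> (0 <= (Normc.normc (u x) ^+ 2 * r x)%:E)%E.
Proof. by move=> x0; rewrite lee_fin mulr_ge0 ?sqr_ge0// ltW// r_gt0. Qed.

Let density_w_ge0 w x : 0 < x -> (0 <= (Normc.normc (w x) ^+ 2 / r x)%:E)%E.
Proof. by move=> x0; rewrite lee_fin divr_ge0 ?sqr_ge0// ltW// r_gt0. Qed.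

(** Rounding x up to an integer n <= x + 1 makes [integral_windows] applicable. Its three integrals
    end at n, n + 1 and n + 2, all below x + 4, whence the factor 3 and the shift 4. *)
Lemma integral_quasi_derivative_le u w x : complex_solution u w -> 0 < x ->
  (\int[mu]_(y in `]0%R, x[) (Normc.normc (w y) ^+ 2 / r y)%:E <=
   (3 * K)%:E * \int[mu]_(y in `]0%R, (x + 4)%R[) (Normc.normc (u y) ^+ 2 * r y)%:E)%E.
Proof.
move=> sol x0; have [mf mg] := measurable_density u w sol.
have [solr soli] := sol.
pose f y := (Normc.normc (u y) ^+ 2 * r y)%:E.
pose g y := (Normc.normc (w y) ^+ 2 / r y)%:E.
have sub (a b : R) (b0 b1 : bool) : 0 < a \/ (a = 0 /\ b0 = false) ->
    [set` Interval (BSide b0 a) (BSide b1 b)] `<=` halfline.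
  move=> h y; case: b0 h; case: b1; rewrite /= !in_itv/= andbT => h /andP[? _]; case: h; lra.
have win (n : nat) y : n%:R < y <= n%:R + 1 ->
    (g y <= K%:E * \int[mu]_(x in `]n%:R, (n%:R + 3)%R]) f x)%E.
  move=> yn; have n0 : 0 <= n%:R :> R by [].
  (* The window around [c] contains [y], lies in ]n, n + 3], and has [1 < c] even if [n = 0]. *)
  pose c : R := n%:R + 1 + (y - n%:R) / 2.
  have c1 : 1 < c by rewrite /c; lra.
  have ca : 0 < c - 1 by lra.
  have yc : c - 1 <= y <= c + 1 by rewrite /c; lra.
  have ir : locally_integrable halfline r by case: coef.
  have iur := integrable_square_weight r _ (c - 1) (c + 1) ir (let: And4 h _ _ _ := solr in h) ca.
  have iui := integrable_square_weight r _ (c - 1) (c + 1) ir (let: And4 h _ _ _ := soli in h) ca.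
  have h1 := window _ _ solr c y c1 yc; have h2 := window _ _ soli c y c1 yc.
  have h : Normc.normc (w y) ^+ 2 / r y <=
      K * \int[mu]_(z in `[c - 1, c + 1]) (Normc.normc (u z) ^+ 2 * r z).
    rewrite normc_sqr mulrDl; apply: le_trans (lerD h1 h2) _.
    rewrite -mulrDr -RintegralD//.
    rewrite le_eqVlt; apply/orP; left; apply/eqP; congr (_ * _).
    by apply: eq_Rintegral => z _; rewrite normc_sqr mulrDl.
  have iu : mu.-integrable `[c - 1, c + 1] (EFin \o (fun z => Normc.normc (u z) ^+ 2 * r z)).
    have := integrableD _ iur iui => /(_ (measurable_itv _)).
    rewrite (_ : (_ \+ _)%E = EFin \o (fun z => Normc.normc (u z) ^+ 2 * r z))//.
    by apply/funext => z /=; rewrite normc_sqr mulrDl EFinD.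
  apply: (@le_trans _ _ (K%:E * \int[mu]_(z in `[(c - 1)%R, (c + 1)%R]) f z)%E).
    rewrite /g; apply: (@le_trans _ _ (K * \int[mu]_(z in `[c - 1, c + 1])
       (Normc.normc (u z) ^+ 2 * r z))%:E); first by rewrite lee_fin.
    by rewrite EFinM /Rintegral fineK//; exact: integrable_fin_num.
  apply: lee_wpmul2l; first by rewrite lee_fin ltW.
  apply: ge0_subset_integral => //.
  - by apply: measurable_funS mf => // z; rewrite /= !in_itv/= andbT => /andP[? _]; lra.
  - by move=> z; rewrite /= in_itv/= => /andP[? _]; apply: density_u_ge0; lra.
  - by move=> z; rewrite /= !in_itv/= /c; lra.
have main := integral_windows f g K (ltW K0) mf mg
  (fun x => @density_u_ge0 u x) (fun x => @density_w_ge0 w x) win.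
pose n := (Num.truncn x).+1.
have xn : x < n%:R by exact: truncnS_gt.
have nx : n%:R <= x + 1.
  by rewrite /n -natr1 lerD2r truncn_le ltW.
apply: (@le_trans _ _ (\int[mu]_(y in `]0%R, n%:R]) g y)%E).
  apply: ge0_subset_integral => //.
  - by apply: measurable_funS mg => // z; rewrite /= !in_itv/= andbT => /andP[? _]; lra.
  - by move=> z; rewrite /= in_itv/= => /andP[? _]; apply: density_w_ge0; lra.
  - by move=> z; rewrite /= !in_itv/=; lra.
apply: le_trans (main n) _; rewrite mulrC EFinM -muleA.
apply: lee_wpmul2l; first by rewrite lee_fin ltW.
set F := (\int[mu]_(y in `]0%R, (x + 4)%R[) _)%E.
have F0 : (0 <= F)%E.
  by apply: integral_ge0 => z; rewrite /= in_itv/= => /andP[? _]; apply: density_u_ge0; lra.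
have -> : (3%:E * F = F + F + F)%E.
  rewrite (_ : 3 = 1 + 1 + 1 :> R); last by lra.
  by rewrite !EFinD !ge0_muleDl ?mul1e ?adde_ge0 ?lee_fin.
have FS b : b < x + 4 -> (\int[mu]_(y in `]0%R, b]) f y <= F)%E.
  move=> bx; apply: ge0_subset_integral => //.
  - by apply: measurable_funS mf => // z; rewrite /= !in_itv/= andbT => /andP[? _]; lra.
  - by move=> z; rewrite /= in_itv/= => /andP[? _]; apply: density_u_ge0; lra.
  - by move=> z; rewrite /= !in_itv/=; lra.
by apply: leeD; [apply: leeD|]; apply: FS; lra.
Qed.

Lemma limsup_quasi_derivative_le u w : complex_solution u w ->
  (limsup_oo (fun x => (x^-1)%:E *
     \int[mu]_(y in `]0%R, x[) (Normc.normc (w y) ^+ 2 / r y)%:E)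
   <= (6 * K)%:E * limsup_oo (fun x => (x^-1)%:E *
     \int[mu]_(y in `]0%R, x[) (Normc.normc (u y) ^+ 2 * r y)%:E))%E.
Proof.
(* For x >= 4 the quotient (x + 4) / x is at most 2, which doubles the constant 3 K. *)
move=> sol; apply: (@limsup_le_scaled _ _ _ _ 4); rewrite ?mulr_gt0// => x x4.
have x0 : 0 < x by lra.
have xV : (0 <= (x^-1)%:E)%E by rewrite lee_fin invr_ge0 ltW.
apply: le_trans (lee_wpmul2l xV (integral_quasi_derivative_le u w x sol x0)) _.
rewrite !muleA -!EFinM; apply: lee_wpmul2r.
  by apply: integral_ge0 => z; rewrite /= in_itv/= => /andP[? _]; apply: density_u_ge0; lra.
rewrite lee_fin mulrC -subr_ge0.
have -> : 6 * K * (x + 4)^-1 - 3 * K * x^-1 = 3 * K * (x - 4) / (x * (x + 4)).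
  by field; rewrite !gt_eqF//; lra.
rewrite divr_ge0// ?mulr_ge0 ?(ltW K0) ?(ltW x0)//; lra.
Qed.

Lemma integral_energy_le u w x : complex_solution u w -> 0 < x ->
  (\int[mu]_(y in `]0%R, x[) (Normc.normc (u y) ^+ 2 * r y + Normc.normc (w y) ^+ 2 / r y)%:E
   <= (1 + 3 * K)%:E * \int[mu]_(y in `]0%R, (x + 4)%R[) (Normc.normc (u y) ^+ 2 * r y)%:E)%E.
Proof.
move=> sol x0; have [mf mg] := measurable_density u w sol.
have sub : `]0, x[%classic `<=` halfline.
  by move=> z; rewrite /= !in_itv/= andbT => /andP[? _].
have pos z : `]0, x[%classic z -> 0 < z by rewrite /= in_itv/= => /andP[].
under eq_integral do rewrite EFinD.
rewrite ge0_integralD//; last 4 first.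
- by move=> z /pos; exact: density_u_ge0.
- exact: measurable_funS mf.
- by move=> z /pos; exact: density_w_ge0.
- exact: measurable_funS mg.
set F := (X in (_ <= _ * X)%E).
have F0 : (0 <= F)%E.
  by apply: integral_ge0 => z; rewrite /= in_itv/= => /andP[? _]; apply: density_u_ge0; lra.
rewrite EFinD ge0_muleDl ?mul1e ?lee_fin ?mulr_ge0 ?(ltW K0)//.
apply: leeD; last exact: integral_quasi_derivative_le.
apply: ge0_subset_integral => //.
- by apply: measurable_funS mf => // z; rewrite /= !in_itv/= andbT => /andP[? _]; lra.
- by move=> z; rewrite /= in_itv/= => /andP[? _]; apply: density_u_ge0; lra.
- by move=> z; rewrite /= !in_itv/=; lra.
Qed.

Let weighted_amgm (m a b : R) : 0 < m -> `|a * b| <= m * a ^+ 2 + b ^+ 2 / m.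
Proof.
move=> m0; rewrite normrM -(real_normK (num_real a)) -(real_normK (num_real b)).
set A := `|a|; set B := `|b|; rewrite -subr_ge0.
have A0 : 0 <= A := normr_ge0 a; have B0 : 0 <= B := normr_ge0 b.
have -> : m * A ^+ 2 + B ^+ 2 / m - A * B = ((m * A - B / 2) ^+ 2 + 3 / 4 * B ^+ 2) / m.
  by field; rewrite gt_eqF.
apply: divr_ge0 (ltW m0); have := sqr_ge0 (m * A - B / 2); have := sqr_ge0 B; lra.
Qed.

(** The four real functions are bounded by moduli instead of being fixed as real or imaginary parts,
    so that one statement covers all four combinations. Integrating a weighted bound for |c| over
    (0, x) gives Cauchy-Schwarz. *)
Lemma wronskian_energy u wu v wv (X WX Y WY : R -> R) (c a b x : R) :
  complex_solution u wu -> complex_solution v wv -> 0 < x ->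
  (forall y, X y ^+ 2 <= Normc.normc (u y) ^+ 2) ->
  (forall y, WX y ^+ 2 <= Normc.normc (wu y) ^+ 2) ->
  (forall y, Y y ^+ 2 <= Normc.normc (v y) ^+ 2) ->
  (forall y, WY y ^+ 2 <= Normc.normc (wv y) ^+ 2) ->
  (forall y, 0 < y -> X y * WY y - WX y * Y y = c) ->
  (\int[mu]_(y in `]0%R, (x + 4)%R[) (Normc.normc (u y) ^+ 2 * r y)%:E = a%:E)%E ->
  (\int[mu]_(y in `]0%R, (x + 4)%R[) (Normc.normc (v y) ^+ 2 * r y)%:E = b%:E)%E ->
  (c * x) ^+ 2 <= 4 * ((1 + 3 * K) * a) * ((1 + 3 * K) * b).
Proof.
move=> solu solv x0 hX hWX hY hWY hc ha hb.
have nonneg (f : R -> R[i]) (t : R) :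
    (\int[mu]_(y in `]0%R, (x + 4)%R[) (Normc.normc (f y) ^+ 2 * r y)%:E = t%:E)%E -> 0 <= t.
  move=> E; rewrite -lee_fin -E; apply: integral_ge0 => z.
  by rewrite /= in_itv/= => /andP[? _]; apply: density_u_ge0; lra.
have K1 : 0 <= 1 + 3 * K by have := K0; lra.
rewrite -(real_normK (num_real (c * x))); apply: sqr_le_of_weighted => //.
- by rewrite mulr_ge0// (nonneg u).
- by rewrite mulr_ge0// (nonneg v).
move=> s s0.
have [mfu mgu] := measurable_density u wu solu.
have [mfv mgv] := measurable_density v wv solv.
have eu := integral_energy_le u wu x solu x0.
have ev := integral_energy_le v wv x solv x0.
rewrite ha -EFinM in eu; rewrite hb -EFinM in ev.
have sub : `]0, x[%classic `<=` halfline.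
  by move=> z; rewrite /= !in_itv/= andbT => /andP[? _].
have pos z : `]0, x[%classic z -> 0 < z by rewrite /= in_itv/= => /andP[].
pose E (f g : R -> R[i]) y := (Normc.normc (f y) ^+ 2 * r y + Normc.normc (g y) ^+ 2 / r y)%:E.
have E0 f g z : `]0, x[%classic z -> (0 <= E f g z)%E.
  by move=> /pos z0; rewrite /E EFinD adde_ge0// ?density_u_ge0 ?density_w_ge0.
have mE f g : complex_solution f g -> measurable_fun (`]0, x[%classic : set R) (E f g).
  move=> /measurable_density[mf mg]; rewrite /E.
  apply: (@measurable_funS _ _ _ _ halfline) => //.
  exact: (emeasurable_funD mf mg).
rewrite -lee_fin.
have -> : (`|c * x|%:E = \int[mu]_(y in `]0%R, x[) `|c|%:E)%E.
  rewrite integral_cst//= lebesgue_measure_itv/= lte_fin x0 -EFinB subr0 -EFinM.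
  by rewrite normrM (gtr0_norm x0).
apply: (@le_trans _ _ (\int[mu]_(y in `]0%R, x[) (s%:E * E u wu y + (s^-1)%:E * E v wv y))%E).
  apply: ge0_le_integral => //.
  - apply: emeasurable_funD; apply: measurable_funeM; exact: mE.
  - move=> y /pos y0; rewrite /E -!EFinM -EFinD lee_fin -(hc y y0).
    have ry := r_gt0 y y0.
    apply: le_trans (ler_normB _ _) _.
    (* The weights s r and s / r give each function the weight it carries in the energy: r for [X]
       and [Y], 1 / r for [WX] and [WY]. *)
    have h1 := weighted_amgm (s * r y) (X y) (WY y) (mulr_gt0 s0 ry).
    have h2 := weighted_amgm (s / r y) (WX y) (Y y) (divr_gt0 s0 ry).
    apply: le_trans (lerD h1 h2) _.
    have -> : s * r y * X y ^+ 2 + WY y ^+ 2 / (s * r y) +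
        (s / r y * WX y ^+ 2 + Y y ^+ 2 / (s / r y)) =
      s * (X y ^+ 2 * r y + WX y ^+ 2 / r y) + s^-1 * (Y y ^+ 2 * r y + WY y ^+ 2 / r y).
      by field; rewrite !gt_eqF.
    apply: lerD; rewrite ler_wpM2l ?invr_ge0 ?(ltW s0)//; apply: lerD;
      by rewrite ler_wpM2r ?invr_ge0 ?(ltW ry).
rewrite ge0_integralD//.
- rewrite !ge0_integralZl_EFin ?invr_ge0 ?(ltW s0)//.
  + rewrite EFinD; apply: leeD.
      by rewrite EFinM; apply: lee_wpmul2l => //; rewrite lee_fin ltW.
    by rewrite mulrC EFinM; apply: lee_wpmul2l => //; rewrite lee_fin invr_ge0 ltW.
  + exact: E0.
  + exact: mE.
  + exact: E0.
  + exact: mE.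
- by move=> z /E0 h; rewrite mule_ge0// lee_fin ltW.
- by apply: measurable_funeM; exact: mE.
- by move=> z /E0 h; rewrite mule_ge0// lee_fin invr_ge0 ltW.
- by apply: measurable_funeM; exact: mE.
Qed.

End energy.

(** * Linear dependence and growth of complex solutions *)

Section complex_solutions.
Context {R : realType} (p q r : R -> R) (l : R).
Hypothesis coef : sl_coefficients p q r.
Local Notation mu := (@lebesgue_measure R).
Local Notation complex_solution := (complex_solution p q r l).
Implicit Types (u v w : R -> R[i]).

Lemma complex_solution_lin u wu v wv (a b : R[i]) :
  complex_solution u wu -> complex_solution v wv ->
  complex_solution (fun x => a * u x + b * v x) (fun x => a * wu x + b * wv x).
Proof.
move=> [ur ui] [vr vi]; case: a => ar ai; case: b => br bi.
have Z c U W := @real_solutionZ R p q r l c U W.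
have D U1 W1 U2 W2 := @real_solutionD R p q r l U1 W1 U2 W2.
split.
- have := D _ _ _ _ (D _ _ _ _ (Z ar _ _ ur) (Z (- ai) _ _ ui))
    (D _ _ _ _ (Z br _ _ vr) (Z (- bi) _ _ vi)).
  set f1 := (X in real_solution _ _ _ _ X _); set f2 := (X in real_solution _ _ _ _ _ X).
  congr (real_solution _ _ _ _ _ _); apply/funext => x; rewrite /f1 /f2.
    by case: (u x) => ? ?; case: (v x) => ? ? /=; ring.
  by case: (wu x) => ? ?; case: (wv x) => ? ? /=; ring.
- have := D _ _ _ _ (D _ _ _ _ (Z ai _ _ ur) (Z ar _ _ ui))
    (D _ _ _ _ (Z bi _ _ vr) (Z br _ _ vi)).
  set f1 := (X in real_solution _ _ _ _ X _); set f2 := (X in real_solution _ _ _ _ _ X).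
  congr (real_solution _ _ _ _ _ _); apply/funext => x; rewrite /f1 /f2.
    by case: (u x) => ? ?; case: (v x) => ? ? /=; ring.
  by case: (wu x) => ? ?; case: (wv x) => ? ? /=; ring.
Qed.

Lemma complex_solution_eq0 u w x y : complex_solution u w -> 0 < x -> 0 < y ->
  u x = 0 -> w x = 0 -> u y = 0.
Proof.
move=> [ur ui] x0 y0 ux wx.
have [re0 _] : complex.Re (u y) = 0 /\ complex.Re (w y) = 0.
  by apply: (real_solution_eq0 p q r l coef _ _ x y ur x0 y0); rewrite ux wx.
have [im0 _] : complex.Im (u y) = 0 /\ complex.Im (w y) = 0.
  by apply: (real_solution_eq0 p q r l coef _ _ x y ui x0 y0); rewrite ux wx.
by apply/eqP; rewrite eq_complex re0 im0 !eqxx.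
Qed.

(** By uniqueness, a combination whose initial data at 1 vanish is zero on the half-line, so
    independence passes to the initial data. *)
Lemma lin_indep_wronskian_neq0 u wu v wv : complex_solution u wu ->
  complex_solution v wv -> lin_indep u v -> u 1 * wv 1 - wu 1 * v 1 != 0.
Proof.
move=> su sv li; apply/eqP => W0.
have dep (a b : R[i]) : a * u 1 + b * v 1 = 0 -> a * wu 1 + b * wv 1 = 0 -> a = 0 /\ b = 0.
  move=> e1 e2; apply: li => x x0.
  exact: (complex_solution_eq0 _ _ 1 x (complex_solution_lin u wu v wv a b su sv)).
(* If the Wronskian is zero, (v 1, - u 1) are coefficients of a relation between the data, and then
   so are (wv 1, - wu 1). All data vanish, so even the coefficients (1, 0) give a relation. *)
have [v1 u1] : v 1 = 0 /\ - u 1 = 0.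
  apply: dep; first by ring.
  by rewrite -[RHS]oppr0 -W0; ring.
have {}u1 : u 1 = 0 by apply/eqP; rewrite -oppr_eq0 u1.
have [wv1 wu1] : wv 1 = 0 /\ - wu 1 = 0.
  by apply: dep; [rewrite u1 v1; ring|ring].
have {}wu1 : wu 1 = 0 by apply/eqP; rewrite -oppr_eq0 wu1.
have [/eqP + _] : (1 : R[i]) = 0 /\ (0 : R[i]) = 0.
  by apply: dep; rewrite ?u1 ?wu1 mulr0 mul0r addr0.
by rewrite oner_eq0.
Qed.

(** [wnorm] uses the real-valued integral, which is 0 by default when the extended one is infinite;
    the pointwise bound M^2 ensures finiteness, so the two integrals agree. *)
Lemma bounded_density u (M x : R) : loc_abs_contC u -> 0 < x ->
  (forall y, 0 < y -> Normc.normc ((Num.sqrt (r y))%:C%C * u y) <= M) ->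
  (\int[mu]_(y in `]0%R, x[) (Normc.normc (u y) ^+ 2 * r y)%:E =
   (wnorm r u x ^+ 2)%:E)%E /\ wnorm r u x ^+ 2 <= M ^+ 2 * x.
Proof.
move=> [ru iu] x0 hM; case: coef => _ r0 _ _ [mr _ _].
have bound y : 0 < y -> 0 <= Normc.normc (u y) ^+ 2 * r y <= M ^+ 2.
  move=> y0; have ry := r0 y y0.
  apply/andP; split; first by rewrite mulr_ge0 ?sqr_ge0// ltW.
  have -> : Normc.normc (u y) ^+ 2 * r y = Normc.normc ((Num.sqrt (r y))%:C%C * u y) ^+ 2.
    rewrite !normc_sqr -[in LHS](sqr_sqrtr (ltW ry)).
    by case: (u y) => ? ? /=; ring.
  have h := hM y y0.
  have n0 : 0 <= Normc.normc ((Num.sqrt (r y))%:C%C * u y).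
    by case: (_ * _) => ? ?; exact: sqrtr_ge0.
  by rewrite lerXn2r ?nnegrE// (le_trans n0).
have pos y : `]0, x[%classic y -> 0 < y by rewrite /= in_itv/= => /andP[].
have mf : measurable_fun (`]0, x[%classic : set R)
    (fun y => (Normc.normc (u y) ^+ 2 * r y)%:E).
  apply: (@measurable_funS _ _ _ _ (`]0, +oo[%classic : set R)) => //.
    by move=> y /pos; rewrite /= in_itv/= andbT.
  apply/measurable_EFinP; apply: measurable_funM => //.
  have := measurable_funD (measurable_funX 2 (loc_abs_cont_measurable _ ru))
    (measurable_funX 2 (loc_abs_cont_measurable _ iu)).
  by apply: eq_measurable_fun => y _; rewrite normc_sqr.
have I0 : (0 <= \int[mu]_(y in `]0%R, x[) (Normc.normc (u y) ^+ 2 * r y)%:E)%E.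
  by apply: integral_ge0 => y /pos /bound /andP[? _]; rewrite lee_fin.
have IM : (\int[mu]_(y in `]0%R, x[) (Normc.normc (u y) ^+ 2 * r y)%:E <= (M ^+ 2 * x)%:E)%E.
  have -> : ((M ^+ 2 * x)%:E = \int[mu]_(y in `]0%R, x[) (M ^+ 2)%:E)%E.
    by rewrite integral_cst//= lebesgue_measure_itv/= lte_fin x0 -EFinB subr0 -EFinM.
  apply: ge0_le_integral => //.
    by move=> y /pos /bound /andP[? _]; rewrite lee_fin.
  by move=> y /pos /bound /andP[_ ?]; rewrite lee_fin.
have fin : (\int[mu]_(y in `]0%R, x[) (Normc.normc (u y) ^+ 2 * r y)%:E)%E \is a fin_num.
  by rewrite ge0_fin_numE// (le_lt_trans IM)// ltry.
have E : (\int[mu]_(y in `]0%R, x[) (Normc.normc (u y) ^+ 2 * r y)%:E =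
    (wnorm r u x ^+ 2)%:E)%E.
  by rewrite /wnorm sqr_sqrtr /Rintegral ?fineK// fine_ge0.
by split=> //; rewrite -lee_fin -E.
Qed.

End complex_solutions.

Lemma sqr_eq0_of_small (R : realFieldType) (c L : R) :
  (forall e, 0 < e -> c ^+ 2 <= (L * e) ^+ 2) -> c = 0.
Proof.
move=> H; apply/eqP/negP => /negP c0.
have c2 : 0 < c ^+ 2 by rewrite lt_neqAle sqr_ge0 eq_sym sqrf_eq0 c0.
have L0 := sqr_ge0 L.
(* With this e the bound (L e)^2 is at most c^2 / 4; adding 1 to |L| covers L = 0. *)
have e0 : 0 < `|c| / (2 * (`|L| + 1)).
  by rewrite divr_gt0 ?normr_gt0// mulr_gt0// ltr_pwDr.
have := H _ e0.
have -> : (L * (`|c| / (2 * (`|L| + 1)))) ^+ 2 = c ^+ 2 * (L ^+ 2 / (4 * (`|L| + 1) ^+ 2)).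
  rewrite -(real_normK (num_real c)); field.
  by rewrite gt_eqF// ltr_pwDr.
have : L ^+ 2 / (4 * (`|L| + 1) ^+ 2) <= 1 / 4.
  rewrite ler_pdivrMr; last by rewrite mulr_gt0// exprn_gt0// ltr_pwDr.
  rewrite -(real_normK (num_real L)); have := normr_ge0 L.
  set B := `|L|; have := sqr_ge0 B; nra.
move=> h1 h2; have := ler_wpM2l (ltW c2) h1; lra.
Qed.

(** * Bounded solutions exclude subordinacy *)

Section subordinacy.
Context {R : realType} (p q r : R -> R) (l : R).
Hypothesis coef : sl_coefficients p q r.
Local Notation complex_solution := (complex_solution p q r l).
Variable K : R.
Hypothesis K0 : 0 < K.
Hypothesis window : forall U W, real_solution p q r l U W ->
  forall x y, 1 < x -> x - 1 <= y <= x + 1 ->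
  W y ^+ 2 / r y <= K * \int[@lebesgue_measure R]_(z in `[x - 1, x + 1]) (U z ^+ 2 * r z).

Lemma subordinate_wronskian_eq0 (u wu v wv : R -> R[i]) (X WX Y WY : R -> R) (M c : R) :
  complex_solution u wu -> complex_solution v wv ->
  (forall y, 0 < y -> Normc.normc ((Num.sqrt (r y))%:C%C * u y) <= M) ->
  (forall y, 0 < y -> Normc.normc ((Num.sqrt (r y))%:C%C * v y) <= M) ->
  subordinate_wrt r u v ->
  (forall y, X y ^+ 2 <= Normc.normc (u y) ^+ 2) ->
  (forall y, WX y ^+ 2 <= Normc.normc (wu y) ^+ 2) ->
  (forall y, Y y ^+ 2 <= Normc.normc (v y) ^+ 2) ->
  (forall y, WY y ^+ 2 <= Normc.normc (wv y) ^+ 2) ->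
  (forall y, 0 < y -> X y * WY y - WX y * Y y = c) -> c = 0.
Proof.
move=> su sv hu hv sub hX hWX hY hWY hc.
have au : loc_abs_contC u by case: su => -[? _ _ _] [? _ _ _].
have av : loc_abs_contC v by case: sv => -[? _ _ _] [? _ _ _].
(* In the constant, one factor 2 is the root of the 4 in [wronskian_energy], the other comes from x
   + 4 <= 2 x. *)
apply: (@sqr_eq0_of_small _ _ (4 * (1 + 3 * K) * M ^+ 2)) => e e0.
move/cvgrPdist_lt : sub => /(_ e e0) [N [_ hN]].
(* Fixing one large x is enough: [N] brings x + 4 into the range where the ratio is below e, and 4
   gives x + 4 <= 2 x. *)
pose x := Num.max 4 N.
have x4 : 4 <= x by rewrite le_max lexx.
have xN : N <= x by rewrite le_max lexx orbT.
have x0 : 0 < x by lra.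
have x40 : 0 < x + 4 by lra.
have [Eu _] := bounded_density p q r coef u M (x + 4) au x40 hu.
have [Ev bv] := bounded_density p q r coef v M (x + 4) av x40 hv.
have main := wronskian_energy p q r l coef K K0 window u wu v wv X WX Y WY c _ _ x
  su sv x0 hX hWX hY hWY hc Eu Ev.
have := hN (x + 4) ltac:(lra); rewrite sub0r normrN.
set A := wnorm r u (x + 4) in Eu main *; set B := wnorm r v (x + 4) in Ev main bv *.
have A0 : 0 <= A by exact: sqrtr_ge0.
have B0 : 0 <= B by exact: sqrtr_ge0.
move=> ratio.
have AB : A ^+ 2 * B ^+ 2 <= e ^+ 2 * (M ^+ 2 * (x + 4)) ^+ 2.
  apply: (@le_trans _ _ (e ^+ 2 * (B ^+ 2) ^+ 2)); last first.
    by rewrite ler_wpM2l ?sqr_ge0// lerXn2r ?nnegrE ?sqr_ge0// (le_trans _ bv)// sqr_ge0.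
  (* For B = 0 the ratio is 0 by convention and says nothing about A, but the product on the left
     vanishes. *)
  have [->|Bn0] := eqVneq B 0; first by rewrite expr0n/= !mulr0 expr0n/= mulr0.
  have Bp : 0 < B by rewrite lt_neqAle eq_sym Bn0.
  have AeB : A <= e * B.
    move: ratio; rewrite ger0_norm ?divr_ge0// ltr_pdivrMr//; exact: ltW.
  have : A ^+ 2 <= (e * B) ^+ 2 by rewrite lerXn2r ?nnegrE// mulr_ge0// ltW.
  move=> /(ler_wpM2r (sqr_ge0 B)) /le_trans; apply.
  by rewrite le_eqVlt; apply/orP; left; apply/eqP; ring.
have K1 : 0 <= (1 + 3 * K) ^+ 2 by exact: sqr_ge0.
have x2 : (x + 4) ^+ 2 <= (2 * x) ^+ 2 by rewrite lerXn2r ?nnegrE//; lra.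
have h1 : (c * x) ^+ 2 <= 4 * (1 + 3 * K) ^+ 2 * (e ^+ 2 * (M ^+ 2 * (x + 4)) ^+ 2).
  apply: le_trans main _.
  have -> : 4 * ((1 + 3 * K) * A ^+ 2) * ((1 + 3 * K) * B ^+ 2) =
    4 * (1 + 3 * K) ^+ 2 * (A ^+ 2 * B ^+ 2) by ring.
  by rewrite ler_wpM2l// mulr_ge0.
have h2 : 4 * (1 + 3 * K) ^+ 2 * (e ^+ 2 * (M ^+ 2 * (x + 4)) ^+ 2) <=
    4 * (1 + 3 * K) ^+ 2 * (e ^+ 2 * (M ^+ 2 * (2 * x)) ^+ 2).
  apply: ler_wpM2l; first by rewrite mulr_ge0.
  apply: ler_wpM2l; first exact: sqr_ge0.
  rewrite !(exprMn 2 (M ^+ 2)); apply: ler_wpM2l x2; exact: sqr_ge0.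
have := le_trans h1 h2.
have -> : 4 * (1 + 3 * K) ^+ 2 * (e ^+ 2 * (M ^+ 2 * (2 * x)) ^+ 2) =
  (4 * (1 + 3 * K) * M ^+ 2 * e) ^+ 2 * x ^+ 2 by ring.
by rewrite exprMn ler_pM2r// exprn_gt0.
Qed.

Lemma bounded_not_subordinate :
  (forall u, is_solution p q r l%:C%C u ->
    exists M : R, forall x, 0 < x -> Normc.normc ((Num.sqrt (r x))%:C%C * u x) <= M) ->
  Nset p q r l.
Proof.
move=> bdd [u [solu _ [v [solv li sub]]]].
have [wu [_ ru iu]] := solution_components p q r l coef u solu.
have [wv [_ rv iv]] := solution_components p q r l coef v solv.
have su : complex_solution u wu by [].
have sv : complex_solution v wv by [].
have [Mu hMu] := bdd u solu; have [Mv hMv] := bdd v solv.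
pose M := Num.max Mu Mv.
have hu y : 0 < y -> Normc.normc ((Num.sqrt (r y))%:C%C * u y) <= M.
  by move=> /hMu h; rewrite le_max h.
have hv y : 0 < y -> Normc.normc ((Num.sqrt (r y))%:C%C * v y) <= M.
  by move=> /hMv h; rewrite le_max h orbT.
have re (z : R[i]) : complex.Re z ^+ 2 <= Normc.normc z ^+ 2.
  by rewrite normc_sqr lerDl sqr_ge0.
have im (z : R[i]) : complex.Im z ^+ 2 <= Normc.normc z ^+ 2.
  by rewrite normc_sqr lerDr sqr_ge0.
(* The real part of the complex Wronskian is that of (Re u, Re v) minus that of (Im u, Im v); the
   imaginary part is the sum of the two mixed ones. *)
have zero X WX Y WY : real_solution p q r l X WX -> real_solution p q r l Y WY ->
    (forall y, X y ^+ 2 <= Normc.normc (u y) ^+ 2) ->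
    (forall y, WX y ^+ 2 <= Normc.normc (wu y) ^+ 2) ->
    (forall y, Y y ^+ 2 <= Normc.normc (v y) ^+ 2) ->
    (forall y, WY y ^+ 2 <= Normc.normc (wv y) ^+ 2) -> X 1 * WY 1 - WX 1 * Y 1 = 0.
  move=> sX sY hX hWX hY hWY.
  have [c hc] := wronskian_constant p q r l _ _ _ _ sX sY.
  rewrite hc//; exact: (subordinate_wronskian_eq0 u wu v wv X WX Y WY M).
have := lin_indep_wronskian_neq0 p q r l coef u wu v wv su sv li.
have := zero _ _ _ _ ru rv (fun y => re _) (fun y => re _) (fun y => re _) (fun y => re _).
have := zero _ _ _ _ ru iv (fun y => re _) (fun y => re _) (fun y => im _) (fun y => im _).
have := zero _ _ _ _ iu rv (fun y => im _) (fun y => im _) (fun y => re _) (fun y => re _).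
have := zero _ _ _ _ iu iv (fun y => im _) (fun y => im _) (fun y => im _) (fun y => im _).
case: (u 1) (v 1) (wu 1) (wv 1) => [a b] [c d] [e f] [g h] /= h1 h2 h3 h4 /eqP; apply.
by apply/eqP; rewrite eq_complex /=; apply/andP; split; apply/eqP; lra.
Qed.

End subordinacy.

Theorem corollary2p8 (R : realType) (p q r : R -> R) (lambda : R)
  (hcoef : sl_coefficients p q r)
  (hreg : regular_at0 p q r)
  (hlp : limit_point_at_oo p q r)
  (hr : forall x : R, 1 < x -> (0 < rminus r x /\ rplus r x < +oo)%E)
  (hgamma : bounded_gt1 (fun x => (gamma r x)%:E))
  (hP : bounded_gt1 (fun x =>
     (((Pint p x) ^+ 2)^-1)%:E *
     \int[@lebesgue_measure R]_(y in `[(x - 1)%R, (x + 1)%R]) (((r y) ^+ 2)^-1)%:E)%E)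
  (hq : bounded_gt1 (fun x =>
     \int[@lebesgue_measure R]_(y in `[(x - 1)%R, (x + 1)%R]) (`|q y / r y - lambda| ^+ 2)%:E)%E) :
  (forall u pu' : R -> R[i],
     is_solution p q r lambda%:C%C u -> quasi_derivative p u pu' ->
     exists C : R,
       (limsup_oo (fun x => (x^-1)%:E *
          \int[@lebesgue_measure R]_(y in `]0%R, x[) (Normc.normc (pu' y) ^+ 2 / r y)%:E)
        <= C%:E * limsup_oo (fun x => (x^-1)%:E *
          \int[@lebesgue_measure R]_(y in `]0%R, x[) (Normc.normc (u y) ^+ 2 * r y)%:E))%E)
  /\
  ((forall u : R -> R[i], is_solution p q r lambda%:C%C u ->
      exists M : R, forall x : R, 0 < x ->
        Normc.normc ((Num.sqrt (r x))%:C%C * u x) <= M) ->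
   Nset p q r lambda).
Proof.
have [K K0 window] := window_estimate p q r lambda hcoef hr hgamma hP hq.
split; last exact: bounded_not_subordinate hcoef K K0 window.
move=> u pu' solu qd.
have [w [qdw ru iu]] := solution_components p q r lambda hcoef u solu.
(* This constant comes from the window estimate alone and is the same for all [u]. *)
exists (6 * K).
have := limsup_quasi_derivative_le p q r lambda hcoef K K0 window u w (conj ru iu).
suff -> : (fun x => (x^-1)%:E *
      \int[@lebesgue_measure R]_(y in `]0%R, x[) (Normc.normc (w y) ^+ 2 / r y)%:E)%E =
    (fun x => (x^-1)%:E *
      \int[@lebesgue_measure R]_(y in `]0%R, x[) (Normc.normc (pu' y) ^+ 2 / r y)%:E)%E by [].
apply/funext => x; congr (_ * _)%E; apply: eq_integral => y.
rewrite inE/= in_itv/= => /andP[y0 _].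
by rewrite (quasi_derivative_unique p u w pu' qdw qd y y0).
Qed.
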